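(* Consider the constrained problem (C) and the perturbed penalized problem (PP) described in the context. Let $\bar\varepsilon>0$ be given and let $p^\star$ be an optimal Lagrange multiplier for the constraint $\mathcal Ax=b$ in (C). For $\rho\ge(4\|p^\star\|+8)/\bar\varepsilon$, FDDP applied to (PP) computes a $\bar\varepsilon$-solution of (C) in at most $$\mathcal O\left(\left(\frac{T^2D^4}{\bar\varepsilon^4}\right)^{2^{T-1}-1}\log\left(\frac1{\bar\varepsilon}\right)\right)$$ iterations, where $D=\max_{1\le t\le T}D_t$ and $D_t$ is the diameter of $X_t$.
   Context: **Constrained problem (C).** $x_0\in\mathbb R^{n_0}$ is fixed, $X_0=\{x_0\}$, and $T$ is the number of stages; for $t=1,\ldots,T$, $X_t\subset\mathbb R^{n_t}$ is nonempty, convex, compact with diameter $D_t>0$, and $E_t:\mathbb R^{n_t}\to\mathbb R$ is finite-valued and $\alpha_t$-strongly convex with $\alpha_t\ge0$ (plain convexity if $\alpha_t=0$). $A_t,B_t$ are matrices and $b_t$ vectors of compatible sizes. Let $X=X_1\times\cdots\times X_T$, $E(x)=\sum_{t=1}^TE_t(x_t)$, and let $\mathcal Ax-b$ be the stacked vector with blocks $A_tx_t+B_tx_{t-1}-b_t$, $t=1,\ldots,T$. Problem (C) is $$E^\star=\min\{E(x):\mathcal Ax=b,\ x\in X\}.$$ A point $\bar x=(\bar x_1,\ldots,\bar x_T)\in X$ is a $\bar\varepsilon$-solution of (C) if $E(\bar x)-E^\star\le\bar\varepsilon$ and $\sum_{t=1}^T\|A_t\bar x_t+B_t\bar x_{t-1}-b_t\|^2\le\bar\varepsilon^2$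 (with $\bar x_0=x_0$). An optimal Lagrange multiplier $p^\star$ is a vector with $E^\star=\min_{x\in X}\{E(x)+\langle p^\star,\mathcal Ax-b\rangle\}$. **Perturbed penalized problem (PP).** For $\rho>0$ and arbitrary $x_t^0\in X_t$, set $$E_t^{\bar\varepsilon}(x_t,x_{t-1})=E_t(x_t)+\frac\rho2\|A_tx_t+B_tx_{t-1}-b_t\|^2+\frac{\bar\varepsilon}{2TD_t^2}\|x_t-x_t^0\|^2 .$$ (PP) is $\min_{x\in X}\sum_{t=1}^TE_t^{\bar\varepsilon}(x_t,x_{t-1})$. **FDDP**, applied to $\min_{x\in X}\sum_{t=1}^TF_t(x_t,x_{t-1})$ with tolerance $\varepsilon'>0$ (here $F_t=E_t^{\bar\varepsilon}$ and $\varepsilon'=\bar\varepsilon/2$). Functions: $G_0(x;x_0)=\sum_{t=1}^TF_t(x_t,x_{t-1})$. $\mathcal Q_T\equiv0$ and $\mathcal Q_{t-1}(x_{t-1})=\min_{(u_t,\ldots,u_T)\in X_t\times\cdots\times X_T}\left[F_t(u_t,x_{t-1})+\sum_{s=t+1}^TF_s(u_s,u_{s-1})\right]$. For a convex real-valued $\Gamma_t$, $\mathcal V_{t-1}(x_{t-1};\Gamma_t)=\min_{u_t\in X_t}F_t(u_t,x_{t-1})+\Gamma_t(u_t)$, a convex function of $x_{t-1}$. Shadow: given $x_{t-1}$ and $\Gamma_t$, let $x_t$ be the minimizer of $F_t(\cdot,x_{t-1})+\Gamma_t$ over $X_t$; a convex lower semicontinuous function $\overline\Gamma_t\le\mathcal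 Q_t$ on $X_t$ is a shadow of $\Gamma_t$ if $\overline\Gamma_t(x_t)=\Gamma_t(x_t)$ and $x_t=\operatorname{argmin}_{u_t\in X_t}F_t(u_t,x_{t-1})+\overline\Gamma_t(u_t)$. Step 1. $k=1$, $y^0=(x_1^0,\ldots,x_T^0)\in X$, $\Gamma_T^1\equiv0$. For $t=T-1,\ldots,1$ choose a subgradient $s_t^0$ of $\mathcal V_t(\cdot;\Gamma_{t+1}^1)$ at $x_t^0$ and set $\Gamma_t^1(\cdot)=\mathcal V_t(x_t^0;\Gamma_{t+1}^1)+\langle s_t^0,\cdot-x_t^0\rangle$. Step 2. With $x_0^k=x_0$, for $t=1,\ldots,T$ compute $x_t^k=\operatorname{argmin}_{u_t\in X_t}F_t(u_t,x_{t-1}^k)+\Gamma_t^k(u_t)$ and the optimal value $m_{t-1}^k$. Set $x^k=(x_1^k,\ldots,x_T^k)$; $y^k=y^{k-1}$ if $G_0(y^{k-1};x_0)\le G_0(x^k;x_0)$, else $y^k=x^k$. Step 3. If $p_0^k=G_0(y^k;x_0)-m_0^k\le\varepsilon'$, stop and output $y^k$; else go to Step 4. Step 4. $\Gamma_T^{k+1}\equiv0$. For $t=T-1,\ldots,1$, let $\overline\Gamma_t^k$ be any shadow of $\Gamma_t^k$ (with respect to $x_{t-1}^k$), choose a subgradient $s_t^k$ of $\mathcal V_t(\cdot;\Gamma_{t+1}^{k+1})$ at $x_t^k$, set $\ell_t^{k+1}(\cdot)=\mathcal V_t(x_t^k;\Gamma_{t+1}^{k+1})+\langle s_t^k,\cdot-x_t^k\rangle$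 and $\Gamma_t^{k+1}=\max\{\ell_t^{k+1},\overline\Gamma_t^k\}$. Replace $k$ by $k+1$ and go to Step 2.
   Formalization: The iteration bound is proved as ε̄→0 for a fixed problem and for ρ ≤ K/ε̄ with K arbitrary but fixed, since no bound uniform in all larger ρ holds; the threshold on ε̄ depends on the problem and K. For every ρ ≥ (4‖p*‖+8)/ε̄, FDDP is shown to terminate with an ε̄-solution. *)

(* Defs.v *)
From HB Require Import structures.
From mathcomp Require Import all_boot all_order all_algebra.
From mathcomp Require Import all_classical all_reals all_analysis.

Set Implicit Arguments.
Unset Strict Implicit.
Unset Printing Implicit Defensive.

Import Order.TTheory GRing.Theory Num.Theory.
Import numFieldNormedType.Exports.

Local Open Scope classical_set_scope.
Local Open Scope ring_scope.

(* The library norm on matrices is the sup norm; these are the Euclidean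
   inner product and norm.  Both norms induce the same topology, so [compact]
   and [lower_semicontinuous] have their usual meaning. *)
Definition dot {R : realType} {n : nat} (u v : 'cV[R]_n) : R :=
  \sum_(i < n) u i 0 * v i 0.

Definition enorm {R : realType} {n : nat} (u : 'cV[R]_n) : R :=
  Num.sqrt (dot u u).

Definition diam {R : realType} {n : nat} (S : set 'cV[R]_n) : R :=
  sup [set r | exists u v, [/\ S u, S v & r = enorm (u - v)]].

Definition is_min {R : realType} (S : set R) (m : R) : Prop :=
  S m /\ lbound S m.

Definition is_argmin {R : realType} {V : Type} (S : set V) (f : V -> R)
  (u : V) : Prop := S u /\ forall v, S v -> f u <= f v.

Definition strongly_convex {R : realType} {n : nat} (a : R)
  (f : 'cV[R]_n -> R) : Prop :=
  forall (u v : 'cV[R]_n) (l : R), 0 <= l <= 1 ->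
    f (l *: u + (1 - l) *: v) <=
      l * f u + (1 - l) * f v - a / 2 * l * (1 - l) * enorm (u - v) ^+ 2.

Definition is_subgradient {R : realType} {n : nat} (f : 'cV[R]_n -> R)
  (u s : 'cV[R]_n) : Prop := forall v, f u + dot s (v - u) <= f v.

(* Outside S the points of [subspace S] are isolated, so this is lower
   semicontinuity of the restriction of f to S. *)
Definition lsc_on {R : realType} {n : nat} (S : set 'cV[R]_n)
  (f : 'cV[R]_n -> R) : Prop :=
  lower_semicontinuous (fun u : subspace S => (f u)%:E).

(* Stages are natural numbers; only 0, ..., T are relevant.  Values of families
   at other stages are never inspected. *)
Definition trajectory (R : realType) (dim : nat -> nat) : Type :=
  forall t : nat, 'cV[R]_(dim t).

Definition functions (R : realType) (dim : nat -> nat) : Type :=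
  forall t : nat, 'cV[R]_(dim t) -> R.

(* At t >= 1, t.-1 is the preceding stage. *)
Definition stage_costs (R : realType) (dim : nat -> nat) : Type :=
  forall t : nat, 'cV[R]_(dim t) -> 'cV[R]_(dim t.-1) -> R.

Section FDDP.
Context {R : realType} {dim : nat -> nat}.
Variables (T : nat) (x0 : 'cV[R]_(dim 0)) (X : forall t, set 'cV[R]_(dim t)).
Variable F : stage_costs R dim.

Definition total_cost (x : trajectory R dim) : R :=
  \sum_(1 <= t < T.+1) F (x t) (x t.-1).

(* Q_t; the minimum is written as an infimum, which it equals when attained.
   For t = T the sum is empty and the value is 0. *)
Definition cost_to_go (t : nat) (z : 'cV[R]_(dim t)) : R :=
  inf [set r | exists u : trajectory R dim,
    [/\ u t = z, forall s, (t < s <= T)%N -> X (u s) &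
        r = \sum_(t.+1 <= s < T.+1) F (u s) (u s.-1)]].

(* V_{t-1}(z; G), with G a function of stage t and z a point of stage t-1;
   same remark on the infimum. *)
Definition value (t : nat) (G : 'cV[R]_(dim t) -> R)
  (z : 'cV[R]_(dim t.-1)) : R :=
  inf [set r | exists2 u : 'cV[R]_(dim t), X u & r = F u z + G u].

(* Minimizers below are unique because F is strongly convex in its first
   argument. *)
Definition is_shadow (t : nat) (z : 'cV[R]_(dim t.-1))
  (G Gbar : 'cV[R]_(dim t) -> R) : Prop :=
  [/\ @convex_function R 'cV[R]_(dim t) (X (t:=t)) Gbar,
      lsc_on (X (t:=t)) Gbar,
      forall u, X u -> Gbar u <= cost_to_go u &
      exists2 u, is_argmin (X (t:=t)) (fun v => F v z + G v) u &
        Gbar u = G u /\ is_argmin (X (t:=t)) (fun v => F v z + Gbar v) u].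

(* At stage t, a linearization at x_t of V_t(.; G_{t+1}). *)
Definition is_cut (t : nat) (Gnext : 'cV[R]_(dim t.+1) -> R)
  (z : 'cV[R]_(dim t)) (l : 'cV[R]_(dim t) -> R) : Prop :=
  exists2 s : 'cV[R]_(dim t), is_subgradient (value Gnext) z s &
    forall u, l u = value Gnext z + dot s (u - z).

(* x^k, y^k and (Gamma_t^k)_t.  The iterate of index 0 only carries the
   starting point; its models are unused. *)
Record iterate := Iterate {
  point : trajectory R dim;
  best : trajectory R dim;
  models : functions R dim }.

Definition initial_models (xinit : trajectory R dim) (G : functions R dim) :
  Prop :=
  (forall u, G T u = 0) /\
  forall t, (0 < t < T)%N -> is_cut (@G t.+1) (xinit t) (@G t).

Definition backward_pass (x : trajectory R dim) (G G' : functions R dim) :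
  Prop :=
  (forall u, G' T u = 0) /\
  forall t, (0 < t < T)%N ->
    exists Gbar l, [/\ is_shadow (x t.-1) (@G t) Gbar,
      is_cut (@G' t.+1) (x t) l &
      forall u, G' t u = Num.max (l u) (Gbar u)].

Definition forward_pass (G : functions R dim) (x : trajectory R dim) : Prop :=
  x 0%N = x0 /\
  forall t, (0 < t <= T)%N ->
    is_argmin (X (t:=t)) (fun u => F u (x t.-1) + G t u) (x t).

Definition gap (h : iterate) : R :=
  total_cost (best h) - value (@models h 1) x0.

Variables (tol : R) (xinit : trajectory R dim) (h : nat -> iterate).

Definition stopped (k : nat) : Prop := (0 < k)%N /\ gap (h k) <= tol.

(* h 1, ..., h N are the first N iterations of an execution of FDDP. *)
Definition fddp_run (N : nat) : Prop :=
  [/\ point (h 0) = xinit /\ best (h 0) = xinit,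
      (0 < N)%N -> initial_models xinit (@models (h 1)),
      forall k, (0 < k <= N)%N -> forward_pass (@models (h k)) (point (h k)),
      forall k, (0 < k <= N)%N ->
        best (h k) =
          if total_cost (best (h k.-1)) <= total_cost (point (h k))
          then best (h k.-1) else point (h k) &
      forall k, (0 < k < N)%N ->
        ~ stopped k /\
        backward_pass (point (h k)) (@models (h k)) (@models (h k.+1))].

End FDDP.

(* matA, matB, rhs are A_t, B_t, b_t for t >= 1; modulus is alpha_t. *)
Record problem (R : realType) := Problem {
  stage_dim : nat -> nat;
  block_dim : nat -> nat;
  start : 'cV[R]_(stage_dim 0);
  stage_set : forall t, set 'cV[R]_(stage_dim t);
  modulus : nat -> R;
  stage_obj : forall t, 'cV[R]_(stage_dim t) -> R;
  matA : forall t, 'M[R]_(block_dim t, stage_dim t);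
  matB : forall t, 'M[R]_(block_dim t, stage_dim t.-1);
  rhs : forall t, 'cV[R]_(block_dim t) }.

Section Problem.
Context {R : realType}.
Variables (T : nat) (P : problem R).

Definition standing : Prop :=
  @stage_set R P 0 = [set @start R P] /\
  forall t, (0 < t <= T)%N ->
    [/\ @stage_set R P t !=set0,
        @convex_set R 'cV[R]_(stage_dim P t) (@stage_set R P t),
        compact (@stage_set R P t), 0 < diam (@stage_set R P t) &
        0 <= modulus P t /\ strongly_convex (modulus P t) (@stage_obj R P t)].

(* x_0 = start and x_t \in X_t for 1 <= t <= T. *)
Definition admissible (x : trajectory R (stage_dim P)) : Prop :=
  forall t, (t <= T)%N -> @stage_set R P t (x t).

Definition objective (x : trajectory R (stage_dim P)) : R :=
  \sum_(1 <= t < T.+1) stage_obj (x t).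

Definition residual (t : nat) (u : 'cV[R]_(stage_dim P t))
  (z : 'cV[R]_(stage_dim P t.-1)) : 'cV[R]_(block_dim P t) :=
  matA P t *m u + matB P t *m z - rhs P t.

Definition optimal_value (Estar : R) : Prop :=
  is_min [set r | exists x, [/\ admissible x,
    forall t, (0 < t <= T)%N -> residual (x t) (x t.-1) = 0 &
    r = objective x]] Estar.

(* Vectors with one block per constraint block A_t x_t + B_t x_{t-1} - b_t. *)
Definition multiplier : Type := forall t, 'cV[R]_(block_dim P t).

Definition multiplier_norm (p : multiplier) : R :=
  Num.sqrt (\sum_(1 <= t < T.+1) enorm (p t) ^+ 2).

Definition optimal_multiplier (Estar : R) (p : multiplier) : Prop :=
  is_min [set r | exists2 x, admissible x &
    r = objective x +
      \sum_(1 <= t < T.+1) dot (p t) (residual (x t) (x t.-1))] Estar.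

Definition eps_solution (Estar eps : R) (x : trajectory R (stage_dim P)) :
  Prop :=
  [/\ admissible x, objective x - Estar <= eps &
      \sum_(1 <= t < T.+1) enorm (residual (x t) (x t.-1)) ^+ 2 <= eps ^+ 2].

Definition diameter : R :=
  \big[Num.max/0]_(1 <= t < T.+1) diam (@stage_set R P t).

Definition matrices_bounded (M : R) : Prop :=
  forall t, (0 < t <= T)%N ->
    (forall u, enorm (matA P t *m u) <= M * enorm u) /\
    (forall z, enorm (matB P t *m z) <= M * enorm z).

(* Stage costs of the perturbed penalized problem (PP). *)
Definition pp_cost (eps rho : R) (xinit : trajectory R (stage_dim P)) :
  stage_costs R (stage_dim P) :=
  fun t u z => stage_obj u + rho / 2 * enorm (residual u z) ^+ 2 +
    eps / (2 * T%:R * diam (@stage_set R P t) ^+ 2) * enorm (u - xinit t) ^+ 2.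

(* FDDP on (PP) with tolerance eps / 2, for all choices of subgradients and
   shadows: no execution performs more than [bound] iterations; one that has
   not met the stopping test can be continued; the output of one that has is
   an eps-solution of (C). *)
Definition fddp_solves_within (Estar eps rho : R)
  (xinit : trajectory R (stage_dim P)) (bound : R) : Prop :=
  let F := pp_cost eps rho xinit in
  let run := fddp_run T (@start R P) (@stage_set R P) F (eps / 2) xinit in
  let stop := stopped T (@start R P) (@stage_set R P) F (eps / 2) in
  forall (h : nat -> @iterate R (stage_dim P)) (N : nat), run h N ->
    [/\ N%:R <= bound,
        ~ stop h N -> exists2 h' : nat -> @iterate R (stage_dim P),
          (forall k, (k <= N)%N -> h' k = h k) & run h' N.+1 &
        stop h N -> eps_solution Estar eps (best (h N))].

End Problem.

(* Main.v *)
Require Import Defs.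
From mathcomp Require Import all_boot all_order all_algebra.
From mathcomp Require Import all_classical all_reals all_analysis.
From mathcomp Require Import ring lra zify.

(* Let q_t be the gap between the cost-to-go and the value of the current model
   at the forward iterate x_t, D_t half the smoothness constant L times the
   squared distance between consecutive iterates at stage t, and theta = L / mu.
   A cut bounds the gap by the next one, q_t' <= q_{t+1}' + D_{t+1}, while strong
   convexity around the shadow gives, for every B > 0,
     q_t' <= (1 + 1/B) q_t - D_{t+1} / (2 theta) + (B + 2) theta D_t.
   A suitable convex combination of the two is a contraction of a nested weighted
   sum of q_0, ..., q_{T-2}, because D_0 = 0.  Each stage costs a squaring of the
   rate: the final rate is of order theta^-a with a = 3 * 2^(T-2) - 2.  For the
   penalized problem theta = O(eps^-2) and 2a < 4 (2^(T-1) - 1) when T >= 2, so the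
   stated power of 1/eps absorbs all constants once eps is small. *)

Set Implicit Arguments.
Unset Strict Implicit.
Unset Printing Implicit Defensive.

Import Order.TTheory GRing.Theory Num.Theory.
Import numFieldNormedType.Exports.

Local Open Scope classical_set_scope.
Local Open Scope ring_scope.

(** The obstacle is that a model improves at the old iterate, while the next gap is measured at the
    new one. Moving from one iterate to the next at stage t costs a multiple of [theta * D_t], which
    nothing at stage t pays for; it is paid by the gain [D_t / (2 * theta)] that strong convexity
    gives to the stage before. So later gaps must carry much smaller weights, in the ratio
    [1 / (32 * theta * kappa)] where [kappa] bounds the unpaid cost. As [kappa] is itself of order
    theta over the rate, one more stage squares the rate, up to a factor of order [theta^-2]. The
    stopping test enters through the steps alone: along a forward pass the stage costs telescope, so
    the gap between the bounds is at most [D_1 + ... + D_{T-1}]. The contraction therefore keeps a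
    positive multiple of that sum. A failed test removes a fixed amount from an energy that decays
    geometrically, whence the logarithm. Models are only convex and lower semicontinuous; the
    smoothness of their values comes from the dependence of the stage cost on the preceding
    stage. *)

Section euclidean.
Variable R : realType.
Implicit Types (m n : nat).

(** * Euclidean inner product and norm *)

Lemma dotC n (u v : 'cV[R]_n) : dot u v = dot v u.
Proof. by rewrite /dot; apply: eq_bigr => i _; rewrite mulrC. Qed.

Lemma dotDl n (u v w : 'cV[R]_n) : dot (u + v) w = dot u w + dot v w.
Proof. by rewrite /dot -big_split; apply: eq_bigr => i _; rewrite mxE mulrDl. Qed.

Lemma dotZl n a (u v : 'cV[R]_n) : dot (a *: u) v = a * dot u v.
Proof. by rewrite /dot mulr_sumr; apply: eq_bigr => i _; rewrite mxE mulrA. Qed.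

Lemma dotDr n (u v w : 'cV[R]_n) : dot w (u + v) = dot w u + dot w v.
Proof. by rewrite dotC dotDl !(dotC w). Qed.

Lemma dotZr n a (u v : 'cV[R]_n) : dot u (a *: v) = a * dot u v.
Proof. by rewrite dotC dotZl dotC. Qed.

Lemma dotNl n (u v : 'cV[R]_n) : dot (- u) v = - dot u v.
Proof. by rewrite -scaleN1r dotZl mulN1r. Qed.

Lemma dotNr n (u v : 'cV[R]_n) : dot u (- v) = - dot u v.
Proof. by rewrite dotC dotNl dotC. Qed.

Lemma dot0r n (u : 'cV[R]_n) : dot u 0 = 0.
Proof. by rewrite -(scale0r 0) dotZr mul0r. Qed.

Lemma dot_ge0 n (u : 'cV[R]_n) : 0 <= dot u u.
Proof. by apply: sumr_ge0 => i _; rewrite -expr2 sqr_ge0. Qed.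

Lemma enorm_ge0 n (u : 'cV[R]_n) : 0 <= enorm u.
Proof. exact: sqrtr_ge0. Qed.

Lemma sqr_enorm n (u : 'cV[R]_n) : enorm u ^+ 2 = dot u u.
Proof. by rewrite sqr_sqrtr ?dot_ge0. Qed.

Lemma enorm0 n : enorm (0 : 'cV[R]_n) = 0.
Proof. by rewrite /enorm dot0r sqrtr0. Qed.

Lemma enorm_eq0 n (u : 'cV[R]_n) : enorm u ^+ 2 = 0 -> u = 0.
Proof.
rewrite sqr_enorm /dot => /eqP.
rewrite psumr_eq0 => [/allP u0|k _]; last by rewrite -expr2 sqr_ge0.
apply/matrixP => i j; rewrite ord1 [RHS]mxE; apply/eqP.
by have := u0 i; rewrite mem_index_enum -expr2 sqrf_eq0; exact.
Qed.

Lemma enorm_distC n (u v : 'cV[R]_n) : enorm (u - v) = enorm (v - u).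
Proof. by rewrite /enorm -(opprB v u) dotNl dotNr opprK. Qed.

Lemma sqr_enorm_conv n l (u v : 'cV[R]_n) :
  enorm (l *: u + (1 - l) *: v) ^+ 2 =
  l * enorm u ^+ 2 + (1 - l) * enorm v ^+ 2 - l * (1 - l) * enorm (u - v) ^+ 2.
Proof.
rewrite !sqr_enorm !(dotDl, dotDr, dotZl, dotZr, dotNl, dotNr) (dotC v u); ring.
Qed.

Lemma dot_young n tau (u v : 'cV[R]_n) : 0 < tau ->
  2 * dot u v <= tau * enorm u ^+ 2 + enorm v ^+ 2 / tau.
Proof.
move=> tau0; have := dot_ge0 (tau *: u - v).
rewrite !(dotDl, dotDr, dotZl, dotZr, dotNl, dotNr) (dotC v u) !sqr_enorm => h.
rewrite -(ler_pM2l tau0) mulrDr (mulrC (dot v v)) mulVKf ?gt_eqF//; lra.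
Qed.

Lemma dot_le_norm n (s w : 'cV[R]_n) :
  `|dot s w| <= (\sum_(i < n) `|s i 0|) * `|w|.
Proof.
rewrite mulr_suml; apply: le_trans (ler_norm_sum _ _ _) _.
apply: ler_sum => i _; rewrite normrM ler_wpM2l//.
by rewrite [leRHS]/Num.norm/= mx_normrE; apply/bigmax_geP; right; exists (i, 0).
Qed.

Lemma sqr_enorm_le_norm n (w : 'cV[R]_n) : enorm w ^+ 2 <= n%:R * `|w| ^+ 2.
Proof.
rewrite sqr_enorm /dot.
have -> : n%:R * `|w| ^+ 2 = \sum_(i < n) `|w| ^+ 2 :> R.
  by rewrite sumr_const card_ord mulr_natl.
apply: ler_sum => i _; rewrite -expr2 -real_normK ?num_real// ler_pXn2r ?nnegrE//.
by rewrite [leRHS]/Num.norm/= mx_normrE; apply/bigmax_geP; right; exists (i, 0).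
Qed.

(** The square of a row product is expanded over pairs of columns, and Young's inequality is applied
    to each pair. The constant, [2 * n] times the squared Frobenius norm, is crude, but only its
    existence matters. *)
Lemma mulmx_enorm_bound m n (A : 'M[R]_(m, n)) : exists2 c, 0 <= c &
  forall u, enorm (A *m u) ^+ 2 <= c * enorm u ^+ 2.
Proof.
exists (\sum_(i < m) \sum_(j < n) \sum_(k < n) (A i j ^+ 2 + A i k ^+ 2)).
  by do 3!(apply: sumr_ge0 => ? _); rewrite addr_ge0 ?sqr_ge0.
move=> u; rewrite sqr_enorm {1}/dot mulr_suml; apply: ler_sum => i _.
rewrite !mxE mulr_suml mulr_suml; apply: ler_sum => j _.
rewrite mulr_sumr mulr_suml; apply: ler_sum => k _.
have coord l : u l 0 ^+ 2 <= enorm u ^+ 2.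
  rewrite sqr_enorm /dot (bigD1 l)//= -expr2 lerDl.
  by apply: sumr_ge0 => ? _; rewrite -expr2 sqr_ge0.
have := coord j; have := coord k.
set a := A i j; set b := A i k; set x := u j 0; set y := u k 0; set e := _ ^+ 2.
move=> hy hx; apply: (@le_trans _ _ (a ^+ 2 * y ^+ 2 + b ^+ 2 * x ^+ 2)).
  have := sqr_ge0 (a * y - b * x); have := sqr_ge0 (a * y); have := sqr_ge0 (b * x); nra.
by rewrite mulrDl lerD// ler_wpM2l// sqr_ge0.
Qed.

End euclidean.

(** * Subgradients of finite convex functions *)

Definition convex_on {R : realType} {n : nat} (X : set 'cV[R]_n)
    (f : 'cV[R]_n -> R) : Prop :=
  forall u v l, X u -> X v -> 0 <= l <= 1 ->
    f (l *: u + (1 - l) *: v) <= l * f u + (1 - l) * f v.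

Section subgradients.
Variables (R : realType) (n : nat) (f : 'cV[R]_n -> R).
Hypothesis cf : convex_on setT f.

(** One step of the Hahn-Banach extension: the slope along [e] has to lie above all left and below
    all right difference quotients, and convexity separates these two families. Adding the
    coordinates one at a time then gives a subgradient. *)
Lemma subgradient_coord_ext (x s : 'cV[R]_n) (k : 'I_n) :
  (forall v : 'cV[R]_n, (forall i : 'I_n, (k <= i)%N -> v i 0 = 0) ->
     f x + dot s v <= f (x + v)) ->
  exists s' : 'cV[R]_n, forall v : 'cV[R]_n, (forall i : 'I_n, (k < i)%N -> v i 0 = 0) ->
     f x + dot s' v <= f (x + v).
Proof.
move=> hs; pose e : 'cV[R]_n := delta_mx k 0.
pose V (v : 'cV[R]_n) := forall i : 'I_n, (k <= i)%N -> v i 0 = 0.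
pose S := [set r | exists (w : 'cV[R]_n) (t : R), [/\ V w, 0 < t &
                     r = (f x + dot s w - f (x + w - t *: e)) / t]]%classic.
have ub w (t : R) : V w -> 0 < t -> ubound S ((f (x + w + t *: e) - f x - dot s w) / t).
  move=> Vw t0 _ [w' [t' [Vw' t'0 ->]]] /=.
  rewrite ler_pdivrMr// mulrAC ler_pdivlMr//.
  (* With this weight the two displacements along [e] cancel, so the combination stays where [hs]
     applies. *)
  pose l := t / (t + t').
  have tt0 : 0 < t + t' by rewrite addr_gt0.
  have l01 : 0 <= l <= 1.
    apply/andP; split; first by rewrite /l divr_ge0// ltW.
    by rewrite /l ler_pdivrMr// mul1r lerDl ltW.
  have l1 : 1 - l = t' / (t + t') by rewrite /l; field; rewrite gt_eqF.
  have := @cf (x + w' - t' *: e) (x + w + t *: e) l I I l01.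
  have -> : l *: (x + w' - t' *: e) + (1 - l) *: (x + w + t *: e) =
            x + (l *: w' + (1 - l) *: w).
    rewrite l1 /l; apply/matrixP => i j; rewrite !mxE; field; rewrite gt_eqF//.
  have Vc : V (l *: w' + (1 - l) *: w).
    by move=> i ki; rewrite !mxE Vw// Vw'// !mulr0 addr0.
  move=> h; have := le_trans (hs _ Vc) h.
  rewrite dotDr !dotZr l1 /l => {}h.
  have := ler_wpM2l (ltW tt0) h.
  rewrite !mulrDr.
  have E a : (t + t') * (t / (t + t') * a) = t * a by field; rewrite gt_eqF.
  have E' a : (t + t') * (t' / (t + t') * a) = t' * a by field; rewrite gt_eqF.
  by rewrite !E !E'; lra.
have S0 : S !=set0.
  exists ((f x + dot s 0 - f (x + 0 - 1 *: e)) / 1), 0, 1.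
  by split=> // i _; rewrite mxE.
have V0 : V 0 by move=> i _; rewrite mxE.
have hS : has_sup S.
  by split=> //; exists ((f (x + 0 + 1 *: e) - f x - dot s 0) / 1); exact: ub.
pose c := sup S.
have cpos w (t : R) : V w -> 0 < t -> f x + dot s w + t * c <= f (x + w + t *: e).
  move=> Vw t0; have : c <= (f (x + w + t *: e) - f x - dot s w) / t.
    by apply: sup_le_ub => //; exact: ub.
  by rewrite ler_pdivlMr//; lra.
have cneg w (t : R) : V w -> 0 < t -> f x + dot s w - t * c <= f (x + w - t *: e).
  move=> Vw t0; have : (f x + dot s w - f (x + w - t *: e)) / t <= c.
    by apply: sup_upper_bound => //; exists w, t.
  by rewrite ler_pdivrMr//; lra.
(* Only the coordinate [k] of [s] changes: it becomes the slope [c]. *)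
exists (s + (c - s k 0) *: e) => v hv.
pose t := v k 0; pose w := v - t *: e.
have Vw : V w.
  move=> i; rewrite leq_eqVlt => /predU1P[/val_inj <-|ki].
    by rewrite !mxE !eqxx mulr1 subrr.
  by rewrite !mxE hv// (gtn_eqF ki : i == k = false) mulr0 subrr.
have dote (u : 'cV[R]_n) : dot u e = u k 0.
  rewrite /dot (bigD1 k)//= big1 ?addr0 ?mxE ?eqxx ?mulr1// => i /negPf ik.
  by rewrite mxE ik mulr0.
have -> : dot (s + (c - s k 0) *: e) v = dot s w + t * c.
  rewrite /w dotDl dotZl (dotC e) dote dotDr dotNr dotZr dote -/t; ring.
have -> : x + v = x + w + t *: e by rewrite /w -addrA subrK.
rewrite addrA; case: (ltrgtP t 0) => [t0|t0|t0].
- by have := cneg w (- t) Vw; rewrite oppr_gt0 scaleNr opprK mulNr opprK; apply.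
- exact: cpos.
- by rewrite t0 mul0r scale0r !addr0; exact: hs.
Qed.

Lemma convex_subgradient (x : 'cV[R]_n) : exists s, is_subgradient f x s.
Proof.
suff [s hs] : exists s : 'cV[R]_n, forall v : 'cV[R]_n,
    (forall i : 'I_n, (n <= i)%N -> v i 0 = 0) -> f x + dot s v <= f (x + v).
  exists s => v; have -> : f v = f (x + (v - x)) by rewrite addrC subrK.
  by apply: hs => i; rewrite leqNgt ltn_ord.
suff: forall k, (k <= n)%N -> exists s : 'cV[R]_n, forall v : 'cV[R]_n,
    (forall i : 'I_n, (k <= i)%N -> v i 0 = 0) -> f x + dot s v <= f (x + v).
  by apply.
elim=> [_|k ih kn].
  exists 0 => v hv; have -> : v = 0.
    by apply/matrixP => i j; rewrite ord1 hv// mxE.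
  by rewrite dot0r !addr0.
have [s hs] := ih (ltnW kn).
exact: (@subgradient_coord_ext x s (Ordinal kn) hs).
Qed.

End subgradients.

(** * Convexity, lower semicontinuity and minimizers relative to a set *)

Definition lsc_at {R : realType} {n : nat} (X : set 'cV[R]_n)
    (f : 'cV[R]_n -> R) : Prop :=
  forall p a, X p -> a < f p ->
    exists2 V, nbhs p V & forall y, V y -> X y -> a < f y.

Definition convex_subset {R : realType} {n : nat} (X : set 'cV[R]_n) : Prop :=
  forall u v (l : R), X u -> X v -> 0 <= l <= 1 -> X (l *: u + (1 - l) *: v).

Definition strongly_convex_on {R : realType} {n : nat} (mu : R)
    (X : set 'cV[R]_n) (f : 'cV[R]_n -> R) : Prop :=
  forall u v l, X u -> X v -> 0 <= l <= 1 ->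
    f (l *: u + (1 - l) *: v) <=
      l * f u + (1 - l) * f v - mu / 2 * l * (1 - l) * enorm (u - v) ^+ 2.

Section convex_lsc.
Variables (R : realType) (n : nat).
Implicit Types (X : set 'cV[R]_n) (f g : 'cV[R]_n -> R).

Lemma lsc_onP X f : lsc_on X f <-> lsc_at X f.
Proof.
split=> [h p a Xp ap|h p a].
  have [|V nV hV] := h p a; first by rewrite lte_fin.
  move: nV; case: (nbhs_subspaceP X p) => // _ nV.
  exists [set y | X y -> V y] => // y /[apply] /hV; rewrite lte_fin; exact.
rewrite lte_fin => ap; case: (nbhs_subspaceP X p) => Xp.
  have [V nV hV] := h p a Xp ap.
  exists (V `&` X) => [|y [Vy Xy]]; last by rewrite lte_fin; exact: hV.
  by apply: filterS nV => y Vy Xy.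
by exists [set p] => // y ->; rewrite lte_fin.
Qed.

Lemma convex_setP X :
  @convex_set R 'cV[R]_n X <-> convex_subset X.
Proof.
split=> [h u v l Xu Xv /andP[l0 l1]|h u v l].
  have := h u v (Itv01 l0 l1); rewrite !in_setE; exact.
rewrite !in_setE => Xu Xv; apply: h => //.
by apply/andP; split; [exact: ge0|exact: le1].
Qed.

Lemma convex_functionP X f :
  @convex_function R 'cV[R]_n X f <-> convex_on X f.
Proof.
split=> [h u v l Xu Xv /andP[l0 l1]|h t u v].
  by have := h (Itv01 l0 l1) u v; rewrite !in_setE; exact.
rewrite !in_setE => Xu Xv; apply: h => //.
by apply/andP; split; [exact: ge0|exact: le1].
Qed.

Lemma convex_on_affine X (c : R) (s p : 'cV[R]_n) :
  convex_on X (fun u => c + dot s (u - p)).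
Proof.
move=> u v l _ _ _; rewrite !(dotDr, dotZr, dotNr).
by rewrite le_eqVlt; apply/orP; left; apply/eqP; ring.
Qed.

Lemma convex_on_max X f g : convex_on X f -> convex_on X g ->
  convex_on X (fun u => Num.max (f u) (g u)).
Proof.
move=> cf cg u v l Xu Xv l01; have /andP[l0 l1] := l01.
have l1' : 0 <= 1 - l by rewrite subr_ge0.
rewrite ge_max; apply/andP; split.
  apply: le_trans (cf _ _ _ Xu Xv l01) _.
  by apply: lerD; apply: ler_wpM2l => //; rewrite le_max lexx.
apply: le_trans (cg _ _ _ Xu Xv l01) _.
by apply: lerD; apply: ler_wpM2l => //; rewrite le_max lexx orbT.
Qed.

Lemma lsc_atD X f g : lsc_at X f -> lsc_at X g -> lsc_at X (fun u => f u + g u).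
Proof.
move=> hf hg p a Xp ap; pose d := (f p + g p - a) / 2.
have [V nV hV] : exists2 V, nbhs p V & forall y, V y -> X y -> f p - d < f y.
  by apply: hf => //; rewrite /d; lra.
have [W nW hW] : exists2 V, nbhs p V & forall y, V y -> X y -> g p - d < g y.
  by apply: hg => //; rewrite /d; lra.
exists (V `&` W) => [|y [Vy Wy] Xy]; first exact: filterI.
by have := hV y Vy Xy; have := hW y Wy Xy; rewrite /d; lra.
Qed.

Lemma lsc_at_max X f g : lsc_at X f -> lsc_at X g ->
  lsc_at X (fun u => Num.max (f u) (g u)).
Proof.
move=> hf hg p a Xp; rewrite lt_max => /orP[/(hf _ _ Xp)|/(hg _ _ Xp)] [V nV hV];
  exists V => // y Vy Xy; rewrite lt_max hV ?orbT//.
Qed.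

(** The affine minorant at the point suffices. Its linear part is Lipschitz for the sup norm with
    the sum of the [|s_i|] as constant; the 1 added in [c] keeps the radius of the ball well
    defined. *)
Lemma lsc_at_convex X f : convex_on setT f -> lsc_at X f.
Proof.
move=> cf p a _ ap; have [s hs] := convex_subgradient cf p.
pose c := 1 + \sum_(i < n) `|s i 0|.
have c0 : 0 < c by rewrite ltr_pwDl// sumr_ge0.
pose d := (f p - a) / c.
have d0 : 0 < d by rewrite divr_gt0// subr_gt0.
exists (ball p d); first exact: nbhsx_ballx.
move=> y; rewrite -ball_normE/= => yd _.
have dc : d * c = f p - a by rewrite /d divfK// gt_eqF.
have h1 : - (c * `|p - y|) <= dot s (y - p).
  rewrite lerNl -dotNr opprB; apply: le_trans (ler_norm _) _.
  apply: le_trans (dot_le_norm _ _) _.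
  by rewrite ler_wpM2r// /c lerDr.
have h2 : c * `|p - y| < f p - a by rewrite -dc mulrC ltr_pM2r.
by have := hs y; lra.
Qed.

(** The sublevel sets are nested and nonempty, so they generate a proper filter. By compactness it
    has a cluster point, and lower semicontinuity puts that point in every sublevel set. *)
Lemma lsc_at_argmin X f : compact X -> X !=set0 -> lsc_at X f ->
  exists u, is_argmin X f u.
Proof.
move=> cX [w Xw] lf.
pose S v := [set u | X u /\ f u <= f v].
pose F := [set A | exists2 v, X v & S v `<=` A].
have FF : ProperFilter F.
  split; first by move=> [v Xv /(_ v)]; apply; split.
  split=> [|A B [v Xv SA] [v' Xv' SB]|A B AB [v Xv SA]].
  - by exists w.
  - have [le|/ltW le] := leP (f v) (f v').
      exists v => // u [Xu fu]; split; first exact: SA.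
      by apply: SB; split=> //; exact: le_trans le.
    exists v' => // u [Xu fu]; split; last exact: SB.
    by apply: SA; split=> //; exact: le_trans le.
  - by exists v => //; exact: subset_trans AB.
have [|p [Xp clp]] := cX F FF; first by exists w => // u [].
exists p; split=> // v Xv; rewrite leNgt; apply/negP => /(lf _ _ Xp) [V nV hV].
have [|u [[Xu fu] Vu]] := clp (S v) V _ nV; first by exists v.
by have := hV u Vu Xu; rewrite ltNge fu.
Qed.

Lemma strong_argmin X (mu : R) f u v : convex_subset X -> 0 <= mu ->
  strongly_convex_on mu X f -> is_argmin X f u -> X v ->
  f u + mu / 2 * enorm (v - u) ^+ 2 <= f v.
Proof.
move=> cX mu0 sf [Xu minu] Xv.
pose c := mu / 2 * enorm (v - u) ^+ 2.
have c0 : 0 <= c by rewrite mulr_ge0 ?exprn_ge0 ?enorm_ge0// divr_ge0.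
have key (l : R) : 0 < l <= 1 -> (1 - l) * c <= f v - f u.
  case/andP=> l0 l1; have l01 : 0 <= l <= 1 by rewrite (ltW l0).
  have := minu _ (cX _ _ _ Xv Xu l01); have := sf _ _ _ Xv Xu l01.
  move=> h1 h2; rewrite -(ler_pM2l l0) /c; lra.
rewrite -lerBrDl -/c leNgt; apply/negP => lt.
have h0 : 0 <= f v - f u by rewrite subr_ge0 minu.
have cp : 0 < c by apply: le_lt_trans lt.
(* In place of the limit of [key] as [l] tends to 0: for this weight [l * c] is half of the supposed
   deficit, which already contradicts [key]. *)
pose l := (c - (f v - f u)) / (2 * c).
have lc : l * c = (c - (f v - f u)) / 2 by rewrite /l; field; rewrite gt_eqF.
have l0 : 0 < l by apply: divr_gt0; [rewrite subr_gt0|rewrite mulr_gt0].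
have l1 : l <= 1 by rewrite -(ler_pM2r cp) lc; lra.
by have := key l; rewrite l0 l1 => /(_ isT); rewrite mulrBl lc; lra.
Qed.

Lemma strong_argmin_unique X (mu : R) f u v : convex_subset X -> 0 < mu ->
  strongly_convex_on mu X f -> is_argmin X f u -> is_argmin X f v -> u = v.
Proof.
move=> cX mu0 sf au [Xv minv].
have := strong_argmin cX (ltW mu0) sf au Xv.
have := minv u au.1.
set d := enorm _ ^+ 2 => h1 h2.
have d0 : d = 0.
  have d_ge0 : 0 <= d by rewrite exprn_ge0// enorm_ge0.
  by apply/eqP; rewrite eq_le d_ge0 andbT -(ler_pM2l (divr_gt0 mu0 (ltr0Sn R 1))) mulr0; lra.
exact/esym/subr0_eq/enorm_eq0.
Qed.

Lemma compact_enorm_bounded X : compact X ->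
  exists c, forall u v, X u -> X v -> enorm (u - v) <= c.
Proof.
move=> /compact_bounded [M [_ hM]].
pose B := `|M| + 1.
have bX u : X u -> `|u| <= B by apply: hM; rewrite /B ltr_pwDr// ler_norm.
have B0 : 0 <= B by rewrite addr_ge0.
exists (Num.sqrt (n%:R * (B + B) ^+ 2)) => u v Xu Xv.
rewrite -[leLHS]ger0_norm ?enorm_ge0// -sqrtr_sqr ler_wsqrtr//.
apply: le_trans (sqr_enorm_le_norm _) _; rewrite ler_wpM2l//.
rewrite ler_pXn2r ?nnegrE ?addr_ge0//.
by apply: le_trans (ler_normB _ _) _; rewrite lerD ?bX.
Qed.

Lemma enorm_le_diam X u v : compact X -> X u -> X v -> enorm (u - v) <= diam X.
Proof.
move=> /compact_enorm_bounded[c hc] Xu Xv; apply: sup_upper_bound.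
  split; first by exists (enorm (u - v)), u, v.
  by exists c => _ [a [b [Xa Xb ->]]]; exact: hc.
by exists u, v.
Qed.

End convex_lsc.

(* [mu] bounds the strong convexity in the current stage from below, [L] bounds
   both the curvature in the preceding stage and the coupling of the two. *)
Record regular_stages {R : realType} {dim : nat -> nat} (T : nat)
    (X : forall t, set 'cV[R]_(dim t)) (F : stage_costs R dim) (mu L : R) :
    Prop := RegularStages {
  regular_set : forall t, (0 < t <= T)%N ->
    [/\ X t !=set0, convex_subset (X t) & compact (X t)];
  regular_lower_bound : forall t, (0 < t <= T)%N ->
    exists m, forall u z, X t u -> m <= F t u z;
  regular_convex : forall t u u' z z' l, (0 < t <= T)%N -> 0 <= l <= 1 ->
    F t (l *: u + (1 - l) *: u') (l *: z + (1 - l) *: z') <=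
    l * F t u z + (1 - l) * F t u' z' -
    mu / 2 * l * (1 - l) * enorm (u - u') ^+ 2;
  regular_cross : forall t u u' z z' tau, (0 < t <= T)%N -> 0 < tau ->
    F t u z' - F t u z - F t u' z' + F t u' z <=
    L / 2 * (tau * enorm (u - u') ^+ 2 + enorm (z' - z) ^+ 2 / tau);
  regular_smooth : forall t u z, (0 < t <= T)%N -> exists g, forall z',
    F t u z' <= F t u z + dot g (z' - z) + L / 2 * enorm (z' - z) ^+ 2 }.

(** * Values of models, cost-to-go functions and the Bellman equation *)

Section dynamic_programming.
Variables (R : realType) (dim : nat -> nat) (T : nat).
Variables (X : forall t, set 'cV[R]_(dim t)) (F : stage_costs R dim).
Arguments X : clear implicits.
Variables (mu L : R).
Hypothesis (mu_gt0 : 0 < mu) (L_gt0 : 0 < L).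
Hypothesis reg : regular_stages T X F mu L.

Local Notation V G z := (value X F G z).
Local Notation Q z := (cost_to_go T X F z).

Section one_stage.
Variable t : nat.
Hypothesis tT : (0 < t <= T)%N.
Implicit Types (G : 'cV[R]_(dim t) -> R).

(** [value] is an infimum of reals, hence meaningful only over sets bounded below; this condition
    together with [regular_lower_bound] guarantees that. *)
Definition bounded_model G := exists m, forall u, X t u -> m <= G u.

Let value_set_lb G z : bounded_model G ->
  has_lbound [set r | exists2 u : 'cV[R]_(dim t), X t u & r = F u z + G u].
Proof.
move=> [m hm]; have [m' hm'] := regular_lower_bound reg tT.
by exists (m' + m) => _ [u Xu ->]; rewrite lerD ?hm ?hm'.
Qed.

Lemma value_le G z u : bounded_model G -> X t u -> V G z <= F u z + G u.
Proof. by move=> bG Xu; apply: ge_inf; [exact: value_set_lb|exists u]. Qed.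

Lemma le_value G z c : (forall u, X t u -> c <= F u z + G u) -> c <= V G z.
Proof.
move=> h; have [[u Xu] _ _] := regular_set reg tT.
by apply: lb_le_inf => [|_ [v Xv ->]]; [exists (F u z + G u), u|exact: h].
Qed.

Lemma value_argmin G z u : is_argmin (X t) (fun v => F v z + G v) u ->
  V G z = F u z + G u.
Proof.
move=> [Xu hu]; apply/eqP; rewrite eq_le le_value// andbT.
by apply: ge_inf; [exists (F u z + G u) => _ [v Xv ->]; exact: hu|exists u].
Qed.

Lemma value_mono G G' z : bounded_model G -> (forall u, X t u -> G u <= G' u) ->
  V G z <= V G' z.
Proof.
move=> bG h; apply: le_value => u Xu.
by apply: le_trans (value_le z bG Xu) _; rewrite lerD2l h.
Qed.

Lemma value_convex G : bounded_model G -> convex_on (X t) G ->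
  convex_on setT (fun z => V G z).
Proof.
move=> bG cG z z' l _ _ l01; have /andP[l0 l1] := l01.
have [_ cX _] := regular_set reg tT.
have joint u u' : X t u -> X t u' -> V G (l *: z + (1 - l) *: z') <=
    l * (F u z + G u) + (1 - l) * (F u' z' + G u').
  move=> Xu Xu'; apply: le_trans (value_le _ bG (cX _ _ _ Xu Xu' l01)) _.
  have := regular_convex reg u u' z z' tT l01; have := cG _ _ _ Xu Xu' l01.
  have : 0 <= mu / 2 * l * (1 - l) * enorm (u - u') ^+ 2.
    by rewrite !mulr_ge0 ?invr_ge0 ?(ltW mu_gt0) ?subr_ge0 ?exprn_ge0 ?enorm_ge0.
  by rewrite !mulrDr; lra.
(* The infima over [u] and [u'] are taken in [joint] one after the other, dividing by [l] and by
   [1 - l]; the two end points are therefore settled first. *)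
move: l0 l1; rewrite le_eqVlt => /predU1P[<- _|l0].
  by rewrite subr0 !scale0r !scale1r !add0r mul0r mul1r add0r.
rewrite le_eqVlt => /predU1P[->|l1].
  by rewrite subrr !scale0r !scale1r !addr0 mul0r mul1r addr0.
have l1' : 0 < 1 - l by rewrite subr_gt0.
rewrite -lerBlDr -ler_pdivrMl//; apply: le_value => u Xu.
rewrite ler_pdivrMl// lerBlDl -lerBlDr -ler_pdivrMl//.
apply: le_value => u' Xu'; rewrite ler_pdivrMl// lerBlDr [leRHS]addrC; exact: joint.
Qed.

Lemma model_argmin G z : convex_on (X t) G -> lsc_at (X t) G ->
  exists u, is_argmin (X t) (fun v => F v z + G v) u.
Proof.
move=> cG lG; have [X0 _ cX] := regular_set reg tT.
apply: lsc_at_argmin => //; apply: lsc_atD => //; apply: lsc_at_convex.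
move=> u u' l _ _ l01; have := regular_convex reg u u' z z tT l01.
have -> : l *: z + (1 - l) *: z = z by rewrite -scalerDl addrC subrK scale1r.
move/le_trans; apply; rewrite gerBl; have /andP[l0 l1] := l01.
by rewrite !mulr_ge0 ?invr_ge0 ?(ltW mu_gt0) ?subr_ge0 ?exprn_ge0 ?enorm_ge0.
Qed.

Lemma lsc_bounded_model G : lsc_at (X t) G -> bounded_model G.
Proof.
have [X0 _ cX] := regular_set reg tT.
by move=> /(lsc_at_argmin cX X0)[u [_ hu]]; exists (G u).
Qed.

Lemma stage_strongly_convex G z : convex_on (X t) G ->
  strongly_convex_on mu (X t) (fun v => F v z + G v).
Proof.
move=> cG u u' l Xu Xu' l01.
have := regular_convex reg u u' z z tT l01; have := cG _ _ _ Xu Xu' l01.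
have -> : l *: z + (1 - l) *: z = z by rewrite -scalerDl addrC subrK scale1r.
by rewrite !mulrDr; lra.
Qed.

Lemma value_growth G z u v : convex_on (X t) G ->
  is_argmin (X t) (fun v => F v z + G v) u -> X t v ->
  V G z + mu / 2 * enorm (v - u) ^+ 2 <= F v z + G v.
Proof.
move=> cG au Xv; have [_ cX _] := regular_set reg tT.
rewrite (value_argmin au).
exact: (strong_argmin cX (ltW mu_gt0) (stage_strongly_convex z cG) au Xv).
Qed.

(* The quadratic upper bound with slope [g] at a minimizer and the subgradient
   inequality force [g = s]. *)
Lemma value_smooth G z s z' : convex_on (X t) G -> lsc_at (X t) G ->
  is_subgradient (fun z => V G z) z s ->
  V G z' <= V G z + dot s (z' - z) + L / 2 * enorm (z' - z) ^+ 2.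
Proof.
move=> cG lG hs; have bG := lsc_bounded_model lG.
have [u au] := model_argmin z cG lG.
have [g hg] := regular_smooth reg u z tT.
have up w : V G w <= V G z + dot g (w - z) + L / 2 * enorm (w - z) ^+ 2.
  apply: le_trans (value_le w bG au.1) _; rewrite (value_argmin au).
  by have := hg w; lra.
suff -> : s = g by exact: up.
have key w : dot (s - g) w <= L / 2 * enorm w ^+ 2.
  have zw : z + w - z = w by rewrite addrC addKr.
  have := hs (z + w); have := up (z + w); rewrite zw.
  by rewrite dotDl dotNl; lra.
(* At the vector [L^-1 *: d], [key] says that [|d|^2 / L] is at most half of itself. *)
pose d := s - g; have := key (L^-1 *: d).
rewrite !sqr_enorm !(dotZr, dotZl) -/d => h.
have d0 : enorm d ^+ 2 = 0.
  apply/eqP; rewrite sqr_enorm eq_le dot_ge0 andbT.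
  have : L^-1 * dot d d <= 2^-1 * (L^-1 * dot d d).
    move: h; congr (_ <= _); field; exact: lt0r_neq0.
  have : 0 < L^-1 by rewrite invr_gt0.
  have := dot_ge0 d; nra.
exact/subr0_eq/enorm_eq0.
Qed.

End one_stage.

Let xget_in t : (0 < t <= T)%N -> X t (xget 0 (X t)).
Proof. by move=> tT; apply: xgetPex; have [] := regular_set reg tT. Qed.

Let cost_to_go_set t (z : 'cV[R]_(dim t)) := [set r | exists u : trajectory R dim,
  [/\ u t = z, forall s, (t < s <= T)%N -> X s (u s) &
      r = \sum_(t.+1 <= s < T.+1) F (u s) (u s.-1)]].

Let cost_to_go_neq0 t (z : 'cV[R]_(dim t)) : cost_to_go_set z !=set0.
Proof.
pose u : trajectory R dim := dfwith (fun s => xget 0 (X s)) t z.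
exists (\sum_(t.+1 <= s < T.+1) F (u s) (u s.-1)), u; split=> //.
  by rewrite /u dfwithin.
move=> s /andP[ts sT]; rewrite /u dfwithout ?(ltn_eqF ts)//.
by apply: xget_in; rewrite sT (leq_ltn_trans _ ts).
Qed.

Let cost_to_go_set_lb t : exists m, forall z : 'cV[R]_(dim t), lbound (cost_to_go_set z) m.
Proof.
have [m hm] : exists m : nat -> R, forall s, (0 < s <= T)%N ->
    forall u z, X s u -> m s <= F u z.
  suff /choice[m hm] : forall s, exists m, (0 < s <= T)%N ->
    forall u z, X s u -> m <= F u z by exists m.
  move=> s; have [sT|_] := boolP (0 < s <= T)%N; last by exists 0.
  by have [m hm] := regular_lower_bound reg sT; exists m.
exists (\sum_(t.+1 <= s < T.+1) m s) => z _ [u [_ hu ->]].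
rewrite big_nat [leRHS]big_nat; apply: ler_sum => s /andP[ts sT].
by apply: hm; [rewrite (leq_ltn_trans _ ts)|apply: hu; rewrite ts].
Qed.

Lemma cost_to_go_lower_bound t : exists m, forall z : 'cV[R]_(dim t), m <= Q z.
Proof.
have [m hm] := cost_to_go_set_lb t; exists m => z.
exact: lb_le_inf (cost_to_go_neq0 z) (hm z).
Qed.

Lemma cost_to_go_last (z : 'cV[R]_(dim T)) : Q z = 0.
Proof.
rewrite /cost_to_go (_ : [set r | _] = [set 0]) ?inf1//.
apply/seteqP; split=> [_ [u [_ _ ->]]|_ ->]; first by rewrite big_geq.
have [r [u [uz hu rE]]] := cost_to_go_neq0 z.
by exists u; split=> //; rewrite big_geq.
Qed.

Lemma cost_to_go_le (u : trajectory R dim) t :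
  (forall s, (t < s <= T)%N -> X s (u s)) ->
  Q (u t) <= \sum_(t.+1 <= s < T.+1) F (u s) (u s.-1).
Proof.
move=> hu; apply: ge_inf; last by exists u.
by have [m hm] := cost_to_go_set_lb t; exists m; exact: hm.
Qed.

Lemma bellman t (z : 'cV[R]_(dim t)) : (t < T)%N ->
  Q z = V (fun v : 'cV[R]_(dim t.+1) => Q v) z.
Proof.
move=> tT; have tT' : (0 < t.+1 <= T)%N by [].
have [m hm] := cost_to_go_lower_bound t.+1.
apply/eqP; rewrite eq_le; apply/andP; split.
  apply: le_value => // v Xv; rewrite -lerBlDl.
  apply: lb_le_inf; first exact: cost_to_go_neq0.
  move=> _ [u [uv hu ->]]; rewrite lerBlDl.
  (* Overwriting stage [t] alone is enough: the cost of the tail reads only later stages. *)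
  pose w : trajectory R dim := dfwith u t z.
  have wt : w t = z by rewrite /w dfwithin.
  have ws s : (t < s)%N -> w s = u s by move=> ts; rewrite /w dfwithout ?(ltn_eqF ts).
  have -> : F v z + \sum_(t.+2 <= s < T.+1) F (u s) (u s.-1) =
      \sum_(t.+1 <= s < T.+1) F (w s) (w s.-1).
    rewrite [RHS]big_ltn// /= wt ws// uv; congr (_ + _).
    rewrite big_nat [RHS]big_nat; apply: eq_bigr => s /andP[ts _].
    by rewrite !ws ?(ltnW ts)//; case: s ts.
  rewrite -wt; apply: cost_to_go_le => s /andP[ts sT]; rewrite ws//.
  by move: ts; rewrite leq_eqVlt => /predU1P[<-|ts]; [rewrite uv|apply: hu; rewrite ts].
apply: lb_le_inf; first exact: cost_to_go_neq0.
move=> _ [u [<- hu ->]]; rewrite big_ltn//=.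
have Xu : X t.+1 (u t.+1) by apply: hu; rewrite ltnSn.
have bQ : bounded_model (fun v : 'cV[R]_(dim t.+1) => Q v) by exists m => v _.
apply: le_trans (value_le tT' (u t) bQ Xu) _.
rewrite lerD2l; apply: cost_to_go_le => s /andP[ts sT].
by apply: hu; rewrite (ltnW ts).
Qed.

(** The invariant of cuts, shadows and models: it provides forward minimizers and subgradients of
    values, and keeps the model values below the optimal cost. *)
Definition valid_model t (G : 'cV[R]_(dim t) -> R) :=
  [/\ convex_on (X t) G, lsc_at (X t) G & forall u, X t u -> G u <= Q u].

End dynamic_programming.

(** * Inequalities for the gaps and steps of one iteration *)

Section one_iteration.
Variables (R : realType) (dim : nat -> nat) (T : nat) (x0 : 'cV[R]_(dim 0)).
Variables (X : forall t, set 'cV[R]_(dim t)) (F : stage_costs R dim).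
Arguments X : clear implicits.
Variables (mu L : R).
Hypothesis (mu_gt0 : 0 < mu) (L_gt0 : 0 < L).
Hypothesis reg : regular_stages T X F mu L.

Local Notation V G z := (value X F G z).
Local Notation Q z := (cost_to_go T X F z).

Definition valid_models (G : functions R dim) : Prop :=
  (forall u, G T u = 0) /\
  forall t, (0 < t <= T)%N -> valid_model T X F (G t).

(** What remains of the cuts made at the previous iterate once the shadow has been added.
    Initialization provides it as well, with the starting point as [y], so that the first iteration
    is not a special case. *)
Definition above_cuts (y : trajectory R dim) (G : functions R dim) : Prop :=
  forall t, (0 < t < T)%N -> exists l,
    is_cut X F (@G t.+1) (y t) l /\ forall u, l u <= G t u.

Definition stage_gap (G : functions R dim) (x : trajectory R dim) (t : nat) : R :=
  Q (x t) - V (@G t.+1) (x t).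

Definition step (x x' : trajectory R dim) (t : nat) : R :=
  L / 2 * enorm (x' t - x t) ^+ 2.

Lemma step_ge0 (x x' : trajectory R dim) t : 0 <= step x x' t.
Proof.
by apply: mulr_ge0; [rewrite divr_ge0// ltW|rewrite exprn_ge0// enorm_ge0].
Qed.

Lemma valid_bounded t (G : 'cV[R]_(dim t) -> R) : (0 < t <= T)%N ->
  valid_model T X F G -> bounded_model X G.
Proof. by move=> tT [_ lG _]; exact: (lsc_bounded_model reg tT lG). Qed.

Lemma value_le_cost_to_go t (G : 'cV[R]_(dim t.+1) -> R) z : (t < T)%N ->
  valid_model T X F G -> V G z <= Q z.
Proof.
move=> tT vG; have tT' : (0 < t.+1 <= T)%N by [].
rewrite (bellman reg)//; apply: (value_mono reg) => //; first exact: valid_bounded.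
by case: vG.
Qed.

Lemma valid_last (G : 'cV[R]_(dim T) -> R) : (forall u, G u = 0) ->
  valid_model T X F G.
Proof.
move=> /funext ->.
have c0 (Y : set 'cV[R]_(dim T)) : convex_on Y (fun=> 0).
  by move=> u v l _ _ _; rewrite !mulr0 addr0.
by split=> [||u _]; [exact: c0|exact: lsc_at_convex|rewrite (cost_to_go_last reg)].
Qed.

Lemma valid_cut t (G : 'cV[R]_(dim t.+1) -> R) z l : (t < T)%N ->
  valid_model T X F G -> is_cut X F G z l -> valid_model T X F l.
Proof.
move=> tT vG [s hs /funext ->].
split=> [||u _]; first exact: convex_on_affine.
  by apply: lsc_at_convex; exact: convex_on_affine.
exact: le_trans (hs u) (value_le_cost_to_go _ tT vG).
Qed.

Lemma valid_modelsP (G : functions R dim) : (forall u, G T u = 0) ->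
  (forall t, (0 < t < T)%N -> valid_model T X F (@G t.+1) ->
     valid_model T X F (@G t)) ->
  valid_models G.
Proof.
move=> GT hG; split=> // t tT.
suff : forall j, (j < T)%N -> valid_model T X F (@G (T - j)%N).
  by move=> /(_ (T - t)%N); rewrite subKn; [apply|]; lia.
elim=> [|j ih] jT; first by rewrite subn0; exact: valid_last.
apply: hG; first by lia.
have -> : (T - j.+1).+1 = (T - j)%N by lia.
by apply: ih; lia.
Qed.

Lemma valid_initial y G : initial_models T X F y G -> valid_models G.
Proof.
move=> [GT hG]; apply: valid_modelsP => // t /andP[t0 tT] vG.
by apply: (valid_cut tT vG); apply: hG; rewrite t0.
Qed.

Lemma valid_backward x G G' : backward_pass T X F x G G' -> valid_models G'.
Proof.
move=> [GT hG]; apply: valid_modelsP => // t /andP[t0 tT] vG.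
have [|Gbar [l [[cb lb leb _] cl /funext ->]]] := hG t; first by rewrite t0.
have [ccl ll lel] := valid_cut tT vG cl.
split=> [||u Xu].
- by apply: convex_on_max => //; exact/convex_functionP.
- by apply: lsc_at_max => //; exact/lsc_onP.
- by rewrite ge_max lel ?leb.
Qed.

Lemma above_initial y G : initial_models T X F y G -> above_cuts y G.
Proof. by move=> [_ hG] t tT; exists (@G t); split=> //; exact: hG. Qed.

Lemma above_backward x G G' : backward_pass T X F x G G' -> above_cuts x G'.
Proof.
move=> [_ hG] t tT; have [Gbar [l [_ cl GE]]] := hG t tT.
by exists l; split=> // u; rewrite GE le_max lexx.
Qed.

Section forward.
Variables (y x : trajectory R dim) (G : functions R dim).
Arguments G : clear implicits.
Hypothesis (vG : valid_models G) (aG : above_cuts y G).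
Hypothesis fx : forward_pass T x0 X F G x.

Lemma forward_value t : (t < T)%N ->
  V (@G t.+1) (x t) = F (x t.+1) (x t) + G t.+1 (x t.+1).
Proof.
move=> tT; have tT' : (0 < t.+1 <= T)%N by [].
exact: (value_argmin reg tT' (fx.2 _ tT')).
Qed.

Lemma forward_feasible t : (0 < t <= T)%N -> X t (x t).
Proof. by move=> /fx.2[]. Qed.

(** By smoothness a cut of the value at [y t] falls below that value by at most the quadratic term,
    and the model dominates the cut. *)
Lemma model_ge t u : (0 < t < T)%N ->
  V (@G t.+1) u - L / 2 * enorm (u - y t) ^+ 2 <= G t u.
Proof.
move=> /[dup] tT /andP[_ tT'].
have [l [[s hs lE] /(_ u)]] := aG tT; rewrite lE; apply: le_trans.
rewrite lerBlDr; have [cG lG _] := vG.2 t.+1 tT'.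
exact: (value_smooth mu_gt0 L_gt0 reg _ _ cG lG hs).
Qed.

Lemma stage_gap_ge0 t : (t < T)%N -> 0 <= stage_gap G x t.
Proof.
move=> tT; rewrite subr_ge0; apply: value_le_cost_to_go => //.
exact: vG.2.
Qed.

Lemma stage_gap_last t : t.+1 = T -> stage_gap G x t = 0.
Proof.
move=> tT; have tT' : (t < T)%N by rewrite -tT.
apply/eqP; rewrite /stage_gap subr_eq0 (bellman reg)//.
(* The stage is generalized because [G] at [t.+1] and the zero model at [T] have different types. *)
have G0 s : s = T -> forall u : 'cV[R]_(dim s), G s u = Q u.
  by move=> -> u; rewrite vG.1 (cost_to_go_last reg).
by have -> : G t.+1 = (fun v : 'cV[R]_(dim t.+1) => Q v) by apply/funext; exact: G0.
Qed.

(** The next iterate is a candidate in the Bellman equation and attains the model value. The stage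
    cost cancels in the difference, and [model_ge] compares what is left. *)
Lemma stage_gap_next t : (t.+1 < T)%N ->
  stage_gap G x t <= stage_gap G x t.+1 + step y x t.+1.
Proof.
move=> tT; have tT0 := ltnW tT; have tT' : (0 < t.+1 <= T)%N by [].
rewrite /stage_gap (bellman reg)// (forward_value tT0).
have [m hm] := cost_to_go_lower_bound reg t.+1.
have bQ : bounded_model X (fun v : 'cV[R]_(dim t.+1) => Q v) by exists m => v _.
have h1 := value_le reg tT' (x t) bQ (forward_feasible tT').
have tT1 : (0 < t.+1 < T)%N by [].
have h2 := model_ge (x t.+1) tT1.
rewrite /step; move: h1 h2 => /=; lra.
Qed.

(** Each stage cost is the difference of a model value and the model at the next iterate; by
    [model_ge] the latter is the next model value up to one step, so the sum telescopes. *)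
Lemma forward_gap_le : (0 < T)%N ->
  total_cost T F x - V (@G 1) x0 <= \sum_(1 <= t < T) step y x t.
Proof.
move=> T0; rewrite /total_cost -fx.1.
have key j : (j < T)%N -> \sum_(1 <= t < j.+1) F (x t) (x t.-1) - V (@G 1) (x 0%N) <=
    \sum_(1 <= t < j.+1) step y x t - V (@G j.+1) (x j).
  elim: j => [|j ih] jT; first by rewrite !big_geq.
  rewrite big_nat_recr//= [in leRHS]big_nat_recr//=.
  have := ih (ltnW jT); rewrite (forward_value (ltnW jT)).
  have jT' : (0 < j.+1 < T)%N by [].
  have := model_ge (x j.+1) jT'; rewrite /step; lra.
have [j jE] : exists j, T = j.+1 by exists T.-1; rewrite prednK.
have jT : (j < T)%N by rewrite jE.
have G0 : G j.+1 (x j.+1) = 0 by rewrite -jE; exact: vG.1.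
have := key j jT; rewrite (forward_value jT) G0 jE [in X in _ -> X]big_nat_recr//=.
lra.
Qed.

End forward.

(** At the old point [z] the shadow has the minimizer and the value of the old model, and at every
    point it lies below the new one. Growth around that minimizer is used twice: at a competitor [v]
    for the cost-to-go, and at the new iterate [u']. Replacing [z] by [z'] leaves a mixed difference
    of [F], which is split at [u] to apply [regular_cross] to the pairs [v], [u] and [u], [u']. *)
Lemma stage_gap_decrease x x' G G' t B : 0 < B -> (t.+1 < T)%N ->
  valid_models G -> forward_pass T x0 X F G x ->
  forward_pass T x0 X F G' x' -> backward_pass T X F x G G' ->
  stage_gap G' x' t <= (1 + B^-1) * stage_gap G x t -
    step x x' t.+1 / (2 * (L / mu)) + (B + 2) * (L / mu) * step x x' t.
Proof.
move=> B0 tT vG fx fx' bp; have tT0 := ltnW tT.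
have tT' : (0 < t.+1 <= T)%N by [].
have [_ cX _] := regular_set reg tT'.
have [|Gbar [l [[cb lb leb [w aw [wG awb]]] cl GE]]] := bp.2 t.+1; first by [].
have cb' := (convex_functionP _ _).1 cb.
have [cG lG _] := vG.2 _ tT'.
set u := x t.+1; set u' := x' t.+1; set z := x t; set z' := x' t.
(* The shadow comes with a minimizer of its own; strong convexity identifies it with the forward
   iterate. *)
have uw : w = u.
  exact: (strong_argmin_unique cX mu_gt0 (stage_strongly_convex reg tT' _ cG) aw (fx.2 _ tT')).
subst w.
have VE : V (@G t.+1) z = V Gbar z.
  by rewrite (forward_value fx tT0) (value_argmin reg tT' awb) wG.
have growth v := value_growth mu_gt0 reg tT' cb' awb (v := v).
have [m hm] := cost_to_go_lower_bound reg t.+1.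
have bQ : bounded_model X (fun v : 'cV[R]_(dim t.+1) => Q v) by exists m => v _.
have Xu' : X t.+1 u' := forward_feasible fx' tT'.
rewrite /stage_gap (forward_value fx' tT0) -/u' -/z' -/z VE.
have LT : 0 < L / mu by rewrite divr_gt0.
have B1 : 0 < 1 + B^-1 by rewrite addr_gt0// invr_gt0.
pose d := L / 2 * enorm (z' - z) ^+ 2.
pose lhs := Q z' - (F u' z' + G' t.+1 u') + mu / 4 * enorm (u' - u) ^+ 2
            - (B + 2) * (L / mu) * d.
suff main : lhs <= (1 + B^-1) * (Q z - V Gbar z).
  have -> : step x x' t.+1 / (2 * (L / mu)) = mu / 4 * enorm (u' - u) ^+ 2.
    by rewrite /step -/u -/u'; field; rewrite !gt_eqF.
  by move: main; rewrite /lhs /d /step -/z -/z'; lra.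
rewrite -ler_pdivrMl// lerBrDr [leRHS](bellman reg)//.
apply: (le_value reg tT') => v Xv.
rewrite -lerBrDr ler_pdivrMl//.
have Qz' : Q z' <= F v z' + Q v by rewrite (bellman reg)//; exact: (value_le reg tT' _ bQ Xv).
have hQ : Gbar v <= Q v := leb v Xv.
have hv := growth v Xv; have hu' := growth u' Xu'.
have hG' : Gbar u' <= G' t.+1 u' by rewrite GE le_max lexx orbT.
(* The first Young parameter makes the cost in [v - u] exactly [B^-1] times the growth at [v]. The
   second spends half of the growth at [u']; the other half is the decrease by the step at
   [t.+1]. *)
have t1 : 0 < mu / (B * L) by rewrite divr_gt0 ?mulr_gt0.
have t2 : 0 < mu / (2 * L) by rewrite divr_gt0 ?mulr_gt0.
have c1 := regular_cross reg v u z z' tT' t1.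
have c2 := regular_cross reg u u' z z' tT' t2.
set ev := enorm (v - u) ^+ 2 in hv c1.
set eu := enorm (u' - u) ^+ 2 in hu' lhs *.
rewrite (enorm_distC u u') -/eu in c2.
have E1 : L / 2 * (mu / (B * L) * ev + enorm (z' - z) ^+ 2 / (mu / (B * L))) =
    B^-1 * (mu / 2 * ev) + B * (L / mu) * d.
  by rewrite /d; field; rewrite !gt_eqF.
have E2 : L / 2 * (mu / (2 * L) * eu + enorm (z' - z) ^+ 2 / (mu / (2 * L))) =
    mu / 4 * eu + 2 * (L / mu) * d.
  by rewrite /d; field; rewrite !gt_eqF.
rewrite E1 in c1; rewrite E2 in c2.
have hB : B^-1 * (mu / 2 * ev) <= B^-1 * (F v z + Q v - V Gbar z).
  by rewrite ler_pM2l ?invr_gt0//; lra.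
rewrite /lhs; lra.
Qed.

End one_iteration.

(** * The Lyapunov function and its contraction rates *)

Section lyapunov.
Variables (R : realType) (theta : R).
Hypothesis theta_ge1 : 1 <= theta.

(* [(eta, kappa, omega)] for the last [i] stages: the Lyapunov function [energy]
   contracts by [1 - eta] up to [kappa] times the step of the first stage, and
   absorbs [omega] times the sum of the other steps. *)
Fixpoint rates (i : nat) : R * R * R :=
  if i is j.+1 then
    let: (eta, kappa, omega) := rates j in
    let lam := (32 * theta * kappa)^-1 in
    let gam := lam * eta / 2 in
    (gam / 2, 4 * theta / gam, lam * omega)
  else (1, 1 / 16, 1 / 16).

Definition contraction_rate i : R := (rates i).1.1.
Definition first_step_weight i : R := (rates i).1.2.
Definition step_weight i : R := (rates i).2.
(** The tail contracts only up to [kappa] times its first step [d 1]. Weighted in this way the error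
    is [d 1 / (32 * theta)], a sixteenth of the decrease [d 1 / (2 * theta)] available at the
    head. *)
Definition coupling i : R := (32 * theta * first_step_weight i)^-1.

Let theta_gt0 : 0 < theta := lt_le_trans ltr01 theta_ge1.

Local Notation eta := contraction_rate.
Local Notation kappa := first_step_weight.
Local Notation omega := step_weight.
Local Notation lam := coupling.

Fixpoint energy (i : nat) (q : nat -> R) : R :=
  if i is j.+1 then q 0%N + lam j * energy j (q \o S) else 0.

Lemma contraction_rateS i : eta i.+1 = lam i * eta i / 2 / 2.
Proof. by rewrite /eta /lam /kappa /=; case: (rates i) => [[]]. Qed.

Lemma first_step_weightS i : kappa i.+1 = 4 * theta / (lam i * eta i / 2).
Proof. by rewrite /eta /lam /kappa /=; case: (rates i) => [[]]. Qed.

Lemma step_weightS i : omega i.+1 = lam i * omega i.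
Proof. by rewrite /omega /lam /kappa /=; case: (rates i) => [[]]. Qed.

Lemma coupling_bounds i : 1 / 16 <= kappa i -> 0 < lam i <= theta^-1 / 2.
Proof.
move=> k; have k0 : 0 < kappa i by lra.
have th1 := theta_ge1; have t0 : 0 < theta := theta_gt0.
have -> : lam i = theta^-1 * (kappa i * 32)^-1.
  by rewrite /lam; field; rewrite !gt_eqF.
rewrite mulr_gt0 ?invr_gt0 ?mulr_gt0//= ler_pM2l ?invr_gt0//.
by rewrite lef_pV2 ?posrE ?mulr_gt0//; lra.
Qed.

Lemma rates_bounds i :
  [/\ 0 < eta i <= 1, 1 / 16 <= kappa i & 0 < omega i <= 1 / 16].
Proof.
elim: i => [|i [/andP[e0 e1] k /andP[w0 w1]]].
  by rewrite /eta /kappa /omega /=; split; lra.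
have th1 := theta_ge1; have t0 : 0 < theta := theta_gt0.
have t1 : theta^-1 <= 1 by rewrite invf_le1.
have /andP[l0 l1] := coupling_bounds k.
have l2 : lam i <= 1 / 2 by lra.
rewrite contraction_rateS first_step_weightS step_weightS.
have le0 : 0 < lam i * eta i by rewrite mulr_gt0.
have le1 : lam i * eta i <= 1 / 2 by nra.
have lw0 : 0 < lam i * omega i by rewrite mulr_gt0.
split; first (apply/andP; split; lra).
  by rewrite ler_pdivlMr; lra.
apply/andP; split; first lra.
nra.
Qed.

Lemma coupling_gt0 i : 0 < lam i.
Proof. by have [_ /coupling_bounds/andP[]] := rates_bounds i. Qed.

Lemma energy_ge0 i (q : nat -> R) : (forall t, (t < i)%N -> 0 <= q t) ->
  0 <= energy i q.
Proof.
elim: i q => //= i ih q hq; apply: addr_ge0; first exact: hq.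
apply: mulr_ge0; first exact/ltW/coupling_gt0.
by apply: ih => t ti; exact: hq.
Qed.

(** For [i = 0] the energy is 0 and the sign of [q i] is the claim itself. *)
Lemma energy_ge_first i (q : nat -> R) : (forall t, (t < i)%N -> 0 <= q t) ->
  q i <= 0 -> q 0%N <= energy i q.
Proof.
case: i => //= i hq _; rewrite lerDl; apply: mulr_ge0; first exact/ltW/coupling_gt0.
by apply: energy_ge0 => t ti; exact: hq.
Qed.

Lemma energy_le i (q : nat -> R) c : 0 <= c ->
  (forall t, (t < i)%N -> q t <= c) -> energy i q <= i%:R * c.
Proof.
move=> c0; elim: i q => [|i ih] q hq /=; first by rewrite mul0r.
have h1 := hq 0%N isT; have h2 : energy i (q \o S) <= i%:R * c.
  by apply: ih => t ti; exact: hq.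
have [_ k _] := rates_bounds i; have /andP[l0 l1] := coupling_bounds k.
have th1 := theta_ge1; have t0 : 0 < theta := theta_gt0.
have t1 : theta^-1 <= 1 by rewrite invf_le1.
have l2 : lam i <= 1 by nra.
have ic0 : 0 <= i%:R * c by rewrite mulr_ge0.
have : lam i * energy i (q \o S) <= i%:R * c.
  apply: le_trans (ler_wpM2l (ltW l0) h2) _; rewrite -[leRHS]mul1r.
  exact: ler_wpM2r.
by rewrite -natr1 mulrDl mul1r; lra.
Qed.

Lemma energy_contraction i (q q' d : nat -> R) :
  (forall t, (t < i)%N -> 0 <= q t) -> (forall t, (t < i)%N -> 0 <= q' t) ->
  (forall t, 0 <= d t) -> q' i <= 0 ->
  (forall t B, (t < i)%N -> 0 < B ->
     q' t <= (1 + B^-1) * q t - d t.+1 / (2 * theta) + (B + 2) * theta * d t) ->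
  (forall t, (t < i)%N -> q' t <= q' t.+1 + d t.+1) ->
  energy i q' + omega i * \sum_(0 <= t < i) d t.+1 <=
    (1 - eta i) * energy i q + kappa i * d 0%N.
Proof.
move=> + + d0; elim: i q q' d d0 => [|i ih] q q' d d0 q0 q'0 ql dec nxt.
  rewrite big_geq// /= !mulr0 !add0r; have [_ k _] := rates_bounds 0.
  by apply: mulr_ge0 => //; lra.
have th1 := theta_ge1; have t0 : 0 < theta := theta_gt0.
have [/andP[e0 e1] k /andP[w0 w1]] := rates_bounds i.
have /andP[l0 l1] := coupling_bounds k.
have IH := ih (q \o S) (q' \o S) (d \o S) (fun t => d0 t.+1)
  (fun t ti => q0 t.+1 ti) (fun t ti => q'0 t.+1 ti) ql
  (fun t B ti => dec t.+1 B ti) (fun t ti => nxt t.+1 ti).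
have first := energy_ge_first (i := i) (q := q' \o S) (fun t ti => q'0 t.+1 ti) ql.
have I2 := nxt 0%N isT.
rewrite contraction_rateS first_step_weightS step_weightS.
rewrite big_nat_recl//= .
have lk : lam i * kappa i = theta^-1 / 32.
  rewrite /lam; field; rewrite !gt_eqF//; lra.
have W0 : 0 <= energy i (q \o S) by apply: energy_ge0 => t ti; exact: q0.
have S0 : 0 <= \sum_(0 <= t < i) d t.+2 by apply: sumr_ge0.
move: IH first I2; rewrite /comp /=.
have d1 := d0 1%N; have d00 := d0 0%N; have q00 := q0 0%N isT.
set W := energy i (fun x => q x.+1) in W0 *.
set W' := energy i (fun x => q' x.+1).
set Sd := \sum_(0 <= t < i) _ in S0 *.
pose gam := lam i * eta i / 2; rewrite -/gam.
have g0 : 0 < gam by rewrite /gam !mulr_gt0.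
pose x := theta^-1.
have x0 : 0 < x by rewrite invr_gt0.
have x1 : x <= 1 by rewrite invf_le1.
rewrite -/x in l1 lk.
have gx : gam <= x / 4 by rewrite /gam; nra.
(* With this [B] the growth factor is [1 + gam / 2], and weighting by [1 - gam] leaves at most
   [1 - gam / 2], the new contraction factor. The factor [(B + 2) * theta] is at most
   [4 * theta / gam], the new [kappa]. *)
have I1 := dec 0%N (2 / gam) isT (divr_gt0 (ltr0Sn R 1) g0).
rewrite invf_div in I1.
have E1 : d 1%N / (2 * theta) = x / 2 * d 1%N by rewrite /x; field; rewrite gt_eqF.
rewrite E1 in I1.
move=> IH first I2.
pose Z := theta / gam.
have Z0 : 0 < Z by rewrite divr_gt0.
have E2 : 4 * theta / gam = 4 * Z by rewrite /Z mulrA.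
have E3 : (2 / gam + 2) * theta = 2 * Z + 2 * theta by rewrite /Z; ring.
rewrite E2; rewrite E3 in I1.
have tZ : theta <= Z by rewrite /Z ler_pdivlMr//; nra.
have g1 : gam <= 1 by lra.
(* Three inequalities are added: the decrease with weight [1 - gam], the cut bound with weight
   [gam], and the induction hypothesis with weight [gam + lam i], whose extra [gam] pays for
   bounding [q' 1] by the energy of the tail. *)
have hI1 := ler_wpM2l (x := 1 - gam) _ I1.
have hI2 := ler_wpM2l (ltW g0) (le_trans I2 (lerD first (lexx _))).
have lg0 : 0 <= gam + lam i by rewrite addr_ge0 ?ltW.
have hIH := ler_wpM2l lg0 IH.
have {}hI1 : (1 - gam) * q' 0%N <=
    (1 - gam) * ((1 + gam / 2) * q 0%N - x / 2 * d 1%N + (2 * Z + 2 * theta) * d 0%N).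
  by apply: hI1; rewrite subr_ge0.
have a1 : (1 - gam) * (1 + gam / 2) * q 0%N <= (1 - gam / 2) * q 0%N.
  by apply: ler_wpM2r => //; nra.
have a2 : (gam + lam i) * (1 - eta i) * W <= (1 - gam / 2) * lam i * W.
  apply: ler_wpM2r => //.
  have ge : gam <= eta i by rewrite /gam; nra.
  have -> : (gam + lam i) * (1 - eta i) = lam i * ((1 + eta i / 2) * (1 - eta i)).
    by rewrite /gam; ring.
  by rewrite [leRHS]mulrC ler_wpM2l ?ltW//; nra.
(* The gain [x / 2] at [d 1] covers all costs: [x / 8] lost by the weight, [x / 4] for the cut
   bound, and three terms of at most [x / 32]. *)
have a3 : (- (1 - gam) * (x / 2) + gam + (gam + lam i) * kappa i + lam i * omega i) * d 1%N <= 0.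
  apply: mulr_le0_ge0 => //.
  have lw : lam i * omega i <= x / 32 by nra.
  have gk : gam * kappa i <= x / 32.
    have -> : gam * kappa i = lam i * kappa i * eta i / 2 by rewrite /gam; ring.
    by rewrite lk; nra.
  have gx' : gam * x <= x / 4 by nra.
  by rewrite mulrDl lk; lra.
have a4 : (1 - gam) * (2 * Z + 2 * theta) * d 0%N <= 4 * Z * d 0%N.
  by apply: ler_wpM2r => //; nra.
have a5 : 0 <= gam * omega i * Sd by apply: mulr_ge0 => //; rewrite ltW ?mulr_gt0.
lra.
Qed.

End lyapunov.

(** * From contraction rates to the number of iterations *)

Section iteration_count.
Variable R : realType.
Implicit Types (theta eps : R).

Lemma rates_inv theta i : 1 <= theta ->
  [/\ (contraction_rate theta i.+1)^-1 =
        128 * theta * first_step_weight theta i * (contraction_rate theta i)^-1,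
      first_step_weight theta i.+1 =
        256 * theta ^+ 2 * first_step_weight theta i * (contraction_rate theta i)^-1 &
      (step_weight theta i.+1)^-1 =
        32 * theta * first_step_weight theta i * (step_weight theta i)^-1].
Proof.
move=> th1; have th0 : 0 < theta := lt_le_trans ltr01 th1.
have [/andP[e0 _] k /andP[w0 _]] := rates_bounds th1 i.
have k0 : 0 < first_step_weight theta i by lra.
rewrite contraction_rateS first_step_weightS step_weightS /coupling.
by split; field; rewrite !gt_eqF.
Qed.

(** If [eta^-1] and [kappa] have orders [theta^a] and [theta^b], the next orders are [1 + a + b] and
    [2 + a + b]. Hence [b = a + 1] after one step, and [a] becomes [2 * a + 2] from the value 1. The
    exponent [e] is left implicit because [omega] will only appear inside a logarithm. *)
Lemma rates_growth i : exists (c : R) (e : nat), 0 < c /\ forall theta, 1 <= theta ->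
  [/\ (contraction_rate theta i.+1)^-1 <= c * theta ^+ (3 * 2 ^ i - 2),
      first_step_weight theta i.+1 <= c * theta ^+ (3 * 2 ^ i - 1) &
      (step_weight theta i.+1)^-1 <= c * theta ^+ e].
Proof.
elim: i => [|i [c [e [c0 ih]]]].
  exists 32, 1%N; split=> // theta th1; have [-> -> ->] := rates_inv 0 th1.
  rewrite /contraction_rate /first_step_weight /step_weight /=.
  have sq : 0 <= theta ^+ 2 by rewrite exprn_ge0//; lra.
  by rewrite !muln1 (_ : 3 - 2 = 1)%N// (_ : 3 - 1 = 2)%N// expr1 invr1; split; lra.
exists (256 * c ^+ 2), (3 * 2 ^ i + e)%N; split; first by rewrite mulr_gt0 ?exprn_gt0.
move=> theta th1; have [-> -> ->] := rates_inv i.+1 th1.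
have th0 : 0 < theta := lt_le_trans ltr01 th1.
have [/andP[e0 _] k /andP[w0 _]] := rates_bounds th1 i.+1.
have k0 : 0 < first_step_weight theta i.+1 by lra.
have [h1 h2 h3] := ih theta th1.
have p0 : (0 < 2 ^ i)%N by rewrite expn_gt0.
set a := (3 * 2 ^ i - 2)%N in h1; have aE : (3 * 2 ^ i - 1 = a.+1)%N by rewrite /a; lia.
rewrite aE in h2.
have -> : (3 * 2 ^ i.+1 - 2 = 1 + a.+1 + a)%N by rewrite expnS /a; lia.
have -> : (3 * 2 ^ i.+1 - 1 = 2 + a.+1 + a)%N by rewrite expnS /a; lia.
have -> : (3 * 2 ^ i + e = 1 + a.+1 + e)%N by rewrite /a; lia.
have prod (d x y u v : R) (j : nat) : 0 <= d -> 0 <= x -> 0 <= y -> d <= 256 ->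
    x <= c * u -> y <= c * v ->
    d * theta ^+ j * x * y <= 256 * c ^+ 2 * (theta ^+ j * u * v).
  move=> d_ge0 x0 y0 d256 xu yv.
  have -> : 256 * c ^+ 2 * (theta ^+ j * u * v) = 256 * theta ^+ j * (c * u) * (c * v) by ring.
  have tj : 0 <= theta ^+ j by rewrite exprn_ge0 ?ltW.
  apply: ler_pM => //; first by rewrite !mulr_ge0.
  apply: ler_pM => //; first by rewrite mulr_ge0.
  exact: ler_wpM2r.
rewrite !exprD; split.
- by rewrite -{1}(expr1 theta); apply: prod => //; [exact: ltW|rewrite invr_ge0 ltW|lra].
- by apply: prod => //; [exact: ltW|rewrite invr_ge0 ltW].
- by rewrite -{1}(expr1 theta); apply: prod => //; [exact: ltW|rewrite invr_ge0 ltW|lra].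
Qed.

(** A failed test at [k.+1] forces the energy at [k] above [om * tol], and geometric decay with
    [1 - eta <= expR (- eta)] limits how long this can last. The 2 stands for the first iteration,
    preceded by no contraction, and the last, whose test may succeed. *)
Lemma count_bound (eta om tol Wm : R) (g W : nat -> R) (N : nat) :
  0 < eta <= 1 -> 0 < om -> 0 < tol -> 0 <= Wm ->
  (forall k, (0 < k < N)%N -> tol < g k) ->
  (forall k, (0 < k <= N)%N -> 0 <= W k) -> W 1%N <= Wm ->
  (forall k, (0 < k < N)%N -> W k.+1 + om * g k.+1 <= (1 - eta) * W k) ->
  N%:R <= 2 + eta^-1 * ln (1 + Wm / (om * tol)).
Proof.
move=> /andP[e0 e1] om0 tol0 Wm0 hg hW W1 dec.
have ot0 : 0 < om * tol by rewrite mulr_gt0.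
have q0 : 0 <= Wm / (om * tol) by rewrite divr_ge0// ltW.
have ln0 : 0 <= ln (1 + Wm / (om * tol)) by rewrite ln_ge0// lerDl.
case: N hg hW dec => [|[|[|m]]] hg hW dec.
1-3: by apply: ler_wpDr; [rewrite mulr_ge0// invr_ge0 ltW|rewrite ler_nat].
have e1' : 0 <= 1 - eta by rewrite subr_ge0.
have geo k : (k < m.+1)%N -> W k.+1 <= (1 - eta) ^+ k * Wm.
  elim: k => [|k ih] km; first by rewrite expr0 mul1r.
  have k1 : (0 < k.+1 < m.+3)%N := leqW (leqW km).
  have k2 : (0 < k.+2 < m.+3)%N := leqW km.
  have := dec _ k1; have := hg _ k2.
  have := ler_wpM2l e1' (ih (ltnW km)); rewrite mulrA -exprS.
  have : om * tol < om * g k.+2 -> 0 < om * g k.+2 by apply: lt_trans.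
  by rewrite ltr_pM2l// => pos h1 /pos h2; lra.
have k1 : (0 < m.+1 < m.+3)%N := leqnSn _.
have k2 : (0 < m.+2 < m.+3)%N := leqnn _.
have h : om * tol < (1 - eta) ^+ m.+1 * Wm.
  have h1 := dec _ k1; have h2 : om * tol < om * g m.+2 by rewrite ltr_pM2l// hg.
  have h3 := ler_wpM2l e1' (geo m (ltnSn m)); rewrite mulrA -exprS in h3.
  have h4 : 0 <= W m.+2 := hW m.+2 (leqnSn _).
  lra.
have hexp : (1 - eta) ^+ m.+1 <= expR (- (m.+1%:R * eta)).
  rewrite -mulrN expRM_natl ler_pXn2r ?nnegrE ?expR_ge0//.
  by rewrite expR_ge1Dx.
have {}h : expR (m.+1%:R * eta) <= 1 + Wm / (om * tol).
  have : expR (m.+1%:R * eta) * (om * tol) <= Wm.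
    have -> : Wm = expR (m.+1%:R * eta) * (expR (- (m.+1%:R * eta)) * Wm).
      by rewrite mulrA expRxMexpNx_1 mul1r.
    rewrite ler_pM2l ?expR_gt0//; apply: le_trans (ltW h) _.
    exact: ler_wpM2r.
  by rewrite -ler_pdivlMr//; lra.
have : m.+1%:R * eta <= ln (1 + Wm / (om * tol)).
  rewrite -(expRK (m.+1%:R * eta)) ler_ln ?posrE ?expR_gt0//.
  by rewrite ltr_pwDl.
rewrite -ler_pdivlMr// mulrC => {}h.
have -> : m.+3%:R = 2 + m.+1%:R :> R by rewrite -natrD.
by rewrite lerD2l.
Qed.

(** The 1 on the left is a spare factor [1 / eps], which outgrows every constant in
    [asymptotic_bound]. *)
Lemma exponent_slack i : (2 * (3 * 2 ^ i - 2) + 1 <= 4 * (2 ^ i.+1 - 1))%N.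
Proof. by rewrite expnS; have := expn_gt0 2 i; lia. Qed.

Lemma asymptotic_bound (i : nat) (K c w : R) : 0 < K -> 0 < c -> 0 < w ->
  exists2 eps0, 0 < eps0 & forall eps theta Wm, 0 < eps -> eps <= eps0 ->
    1 <= theta -> theta <= c / eps ^+ 2 -> 0 <= Wm -> Wm <= w / eps ^+ 2 ->
    2 + (contraction_rate theta i.+1)^-1 *
        ln (1 + Wm / (step_weight theta i.+1 * (eps / 2))) <=
    (K / eps ^+ 4) ^+ (2 ^ i.+1 - 1) * ln (1 / eps).
Proof.
move=> K0 c0 w0; have [d [e [d0 growth]]] := rates_growth i.
pose a := (3 * 2 ^ i - 2)%N; pose m := (2 ^ i.+1 - 1)%N.
pose A := d * c ^+ a; pose B := 2 * w * (d * c ^+ e).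
pose j := (2 * e + 3)%N.
have A0 : 0 < A by rewrite mulr_gt0 ?exprn_gt0.
have B0 : 0 < B by rewrite !mulr_gt0 ?exprn_gt0.
have Km : 0 < K ^+ m by rewrite exprn_gt0.
pose D := 2 + A * j.+1%:R.
have D0 : 0 < D by rewrite ltr_wpDr// mulr_ge0 ?ltW.
(* A lower bound for [x = 1 / eps]: [1 + B] turns the argument of the logarithm into a power of [x],
   [expR 1] gives [1 <= ln x], and the last summand lets the spare factor absorb [D]. *)
pose y := 1 + B + expR 1 + D / K ^+ m.
have DK : 0 < D / K ^+ m by rewrite divr_gt0.
have e10 := expR_gt0 (1 : R).
have y0 : 0 < y by rewrite /y; lra.
exists y^-1; first by rewrite invr_gt0.
move=> eps theta Wm eps0 epsy th1 thc Wm0 Wmw.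
have th0 : 0 < theta := lt_le_trans ltr01 th1.
have [/andP[eta0 _] _ /andP[om0 _]] := rates_bounds th1 i.+1.
have [g1 _ g3] := growth theta th1.
pose x := eps^-1.
have x0 : 0 < x by rewrite invr_gt0.
have yx : y <= x by rewrite -[y]invrK lef_pV2 ?posrE ?invr_gt0.
have x1 : 1 <= x by move: yx; rewrite /y; lra.
have xe : expR 1 <= x by move: yx; rewrite /y; lra.
have xB : 1 + B <= x by move: yx; rewrite /y; lra.
have xD : D <= K ^+ m * x.
  by rewrite -ler_pdivrMl// mulrC; move: yx; rewrite /y; lra.
have {}thc : theta <= c * x ^+ 2 by rewrite /x exprVn.
have {}Wmw : Wm <= w * x ^+ 2 by rewrite /x exprVn.
have powth k : theta ^+ k <= c ^+ k * x ^+ (2 * k).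
  rewrite exprM -exprMn; apply: lerXn2r; rewrite ?nnegrE//; first exact: ltW.
  by apply: mulr_ge0; [exact: ltW|rewrite exprn_ge0// ltW].
have hA : (contraction_rate theta i.+1)^-1 <= A * x ^+ (2 * a).
  by apply: le_trans g1 _; rewrite /A -mulrA ler_wpM2l ?(ltW d0).
have hw : (step_weight theta i.+1)^-1 <= d * c ^+ e * x ^+ (2 * e).
  by apply: le_trans g3 _; rewrite -mulrA ler_wpM2l ?(ltW d0).
set arg := Wm / _.
have arg0 : 0 <= arg.
  by apply: divr_ge0 => //; rewrite ltW// mulr_gt0// divr_gt0.
have hB : arg <= B * x ^+ j.
  have -> : arg = 2 * x * (Wm * (step_weight theta i.+1)^-1).
    by rewrite /arg /x; field; rewrite !gt_eqF.
  have -> : B * x ^+ j = 2 * x * (w * x ^+ 2 * (d * c ^+ e * x ^+ (2 * e))).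
    by rewrite /B /j exprD (exprS x 2); ring.
  apply: ler_wpM2l; first by rewrite mulr_ge0// ltW.
  by apply: ler_pM => //; rewrite invr_ge0 ltW.
have lnx : ln (1 / eps) = ln x by rewrite div1r.
have lnx1 : 1 <= ln x by rewrite -(expRK 1) ler_ln ?posrE.
have hln : ln (1 + arg) <= j.+1%:R * ln x.
  rewrite mulr_natl -lnXn// ler_ln ?posrE ?exprn_gt0 ?ltr_pwDl//.
  have xj : 1 <= x ^+ j by rewrite exprn_ege1.
  by rewrite exprS; nra.
have hln0 : 0 <= ln (1 + arg) by rewrite ln_ge0// lerDl.
have hprod : (contraction_rate theta i.+1)^-1 * ln (1 + arg) <=
    A * x ^+ (2 * a) * (j.+1%:R * ln x).
  by apply: ler_pM => //; rewrite invr_ge0 ltW.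
rewrite lnx -/m.
have x2a : 1 <= x ^+ (2 * a) by rewrite exprn_ege1.
apply: (@le_trans _ _ (D * x ^+ (2 * a) * ln x)).
  apply: le_trans (lerD (lexx _) hprod) _; rewrite /D.
  have : 1 <= x ^+ (2 * a) * ln x by rewrite -[1]mulr1 ler_pM.
  by rewrite !mulrDl; lra.
rewrite ler_wpM2r ?(le_trans ler01)//.
have -> : (K / eps ^+ 4) ^+ m = K ^+ m * x ^+ (4 * m).
  by rewrite -exprVn -/x exprMn exprM.
have am : (2 * a + 1 <= 4 * m)%N := exponent_slack i.
apply: (@le_trans _ _ (K ^+ m * x * x ^+ (2 * a))).
  by rewrite ler_wpM2r// exprn_ge0// ltW.
by rewrite -mulrA -exprS -addn1 ler_wpM2l ?ler_weXn2l// ltW.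
Qed.

End iteration_count.

(** * Executions: invariants, length, output and continuation *)

Section runs.
Variables (R : realType) (dim : nat -> nat) (T : nat) (x0 : 'cV[R]_(dim 0)).
Variables (X : forall t, set 'cV[R]_(dim t)) (F : stage_costs R dim).
Arguments X : clear implicits.
Variables (mu L : R).
Hypothesis (mu_gt0 : 0 < mu) (muL : mu <= L).
Hypothesis reg : regular_stages T X F mu L.
Hypothesis T_gt0 : (0 < T)%N.
Variables (tol : R) (xinit : trajectory R dim).
Hypothesis tol_gt0 : 0 < tol.

Let L_gt0 : 0 < L := lt_le_trans mu_gt0 muL.

Local Notation V G z := (value X F G z).

(** Initialization and the backward pass both choose the model of a stage once that of the next
    stage is known. The family is built down from [T], overwriting one stage at a time and carrying
    the invariant [P]. *)
Lemma backward_family (P : forall t, ('cV[R]_(dim t) -> R) -> Prop)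
    (rel : forall t, ('cV[R]_(dim t.+1) -> R) -> ('cV[R]_(dim t) -> R) -> Prop) :
  P T (fun=> 0) ->
  (forall t (G : 'cV[R]_(dim t.+1) -> R), (0 < t < T)%N -> P t.+1 G ->
     exists2 G', P t G' & rel t G G') ->
  exists G : functions R dim, (forall u, G T u = 0) /\
    forall t, (0 < t < T)%N -> rel t (@G t.+1) (@G t).
Proof.
move=> P0 hP.
suff key j : (j < T)%N -> exists G : functions R dim, [/\ G T = (fun=> 0),
    P (T - j)%N (@G (T - j)%N) &
    forall t, (T - j <= t < T)%N -> rel t (@G t.+1) (@G t)].
  have [|G [GT _ hG]] := key T.-1; first by lia.
  exists G; split=> [u|t tT]; first by rewrite GT.
  by apply: hG; lia.
elim: j => [|j ih] jT.
  pose G : functions R dim := fun t _ => 0.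
  exists G; split=> //; first by rewrite subn0.
  by move=> t; rewrite subn0; lia.
have [G [GT PG hG]] := ih (ltnW jT).
have sE : (T - j = (T - j.+1).+1)%N by lia.
move: PG hG; rewrite sE; set s := (T - j.+1)%N => PG hG.
have [|G' PG' rG'] := hP s (@G s.+1) _ PG; first by rewrite /s; lia.
pose H : functions R dim := dfwith G s G'.
have Hs : @H s = G' by rewrite /H dfwithin.
have Ht t : (s < t)%N -> @H t = @G t by move=> st; rewrite /H dfwithout// ltn_eqF.
exists H; split.
- by rewrite Ht ?GT// /s; lia.
- by rewrite Hs.
- move=> t /andP[]; rewrite leq_eqVlt => /predU1P[<- _|st tT].
    by rewrite Hs Ht.
  by rewrite !Ht ?(ltnW st)//; [apply: hG; rewrite st|exact: leqW].
Qed.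

Lemma cut_exists t (G : 'cV[R]_(dim t.+1) -> R) z : (t < T)%N ->
  valid_model T X F G -> exists2 l, valid_model T X F l & is_cut X F G z l.
Proof.
move=> tT vG; have tT' : (0 < t.+1 <= T)%N by [].
have [cG _ _] := vG.
have [s hs] := convex_subgradient (value_convex mu_gt0 reg tT' (valid_bounded reg tT' vG) cG) z.
have cl : is_cut X F G z (fun u => V G z + dot s (u - z)) by exists s.
by exists (fun u => V G z + dot s (u - z)) => //; exact: (valid_cut reg tT vG cl).
Qed.

Lemma initial_models_exist : exists G, initial_models T X F xinit G.
Proof.
apply: (@backward_family (fun t G => valid_model T X F G)
  (fun t G G' => is_cut X F G (xinit t) G')); first exact: (valid_last reg).
by move=> t G /andP[_ tT]; exact: cut_exists.
Qed.

Lemma backward_pass_exists x G : valid_models T X F G ->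
  forward_pass T x0 X F G x -> exists G', backward_pass T X F x G G'.
Proof.
move=> vG fx.
apply: (@backward_family (fun t G => valid_model T X F G)
  (fun t H H' => exists Gbar l, [/\ is_shadow T X F (x t.-1) (@G t) Gbar,
      is_cut X F H (x t) l & forall u, H' u = Num.max (l u) (Gbar u)])).
  exact: (valid_last reg).
move=> t H /andP[t0 tT] vH.
have [l [cl ll lel] hl] := cut_exists (x t) tT vH.
have tT' : (0 < t <= T)%N by rewrite t0 ltnW.
have [cG lG leG] := vG.2 t tT'.
exists (fun u => Num.max (l u) (G t u)).
  split; [exact: convex_on_max|exact: lsc_at_max|].
  by move=> u Xu; rewrite ge_max lel ?leG.
(* A valid model is a shadow of itself. *)
exists (@G t), l; split=> //; split=> //; first exact/convex_functionP.
  exact/lsc_onP.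
by have [_ /(_ t tT') ax] := fx; exists (x t).
Qed.

Lemma forward_pass_exists G : valid_models T X F G ->
  exists x, forward_pass T x0 X F G x.
Proof.
move=> vG.
suff key j : (j <= T)%N -> exists x : trajectory R dim, x 0%N = x0 /\
    forall t, (0 < t <= j)%N ->
      is_argmin (X t) (fun u => F u (x t.-1) + G t u) (x t) by exact: key.
elim: j => [_|j ih jT].
  exists (dfwith (fun t => 0 : 'cV[R]_(dim t)) 0%N x0); split; first by rewrite dfwithin.
  by move=> t; lia.
have [x [xx0 hx]] := ih (ltnW jT).
have jT' : (0 < j.+1 <= T)%N by [].
have [cG lG _] := vG.2 _ jT'.
have [u au] := model_argmin mu_gt0 reg jT' (x j) cG lG.
pose y : trajectory R dim := dfwith x j.+1 u.
have yj : y j.+1 = u by rewrite /y dfwithin.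
have yt t : (t <= j)%N -> y t = x t by move=> tj; rewrite /y dfwithout// gtn_eqF.
exists y; split; first by rewrite yt.
move=> t /andP[t0]; rewrite leq_eqVlt => /predU1P[->|tj] /=.
  by rewrite yj yt.
by rewrite !yt//; [apply: hx; rewrite t0|lia].
Qed.

Section one_run.
Variables (h : nat -> @iterate R dim) (N : nat).
Hypothesis run : fddp_run T x0 X F tol xinit h N.

Lemma run_models_valid k : (0 < k <= N)%N -> valid_models T X F (@models _ _ (h k)).
Proof.
case: run => _ init _ _ bwd; case: k => // -[|k] kN.
  exact: (valid_initial mu_gt0 L_gt0 reg (init kN)).
by have [_ bp] := bwd k.+1 kN; exact: (valid_backward mu_gt0 L_gt0 reg bp).
Qed.

Lemma run_above_cuts k : (0 < k <= N)%N ->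
  above_cuts T X F (Defs.point (h k.-1)) (@models _ _ (h k)).
Proof.
case: run => -[p0 _] init _ _ bwd; case: k => // -[|k] kN.
  by rewrite p0; exact: (above_initial (init kN)).
by have [_ bp] := bwd k.+1 kN; exact: (above_backward bp).
Qed.

Lemma run_forward k : (0 < k <= N)%N ->
  forward_pass T x0 X F (@models _ _ (h k)) (Defs.point (h k)).
Proof. by case: run => _ _ + _ _; exact. Qed.

Lemma run_best_le k : (0 < k <= N)%N ->
  total_cost T F (best (h k)) <= total_cost T F (Defs.point (h k)).
Proof.
by case: run => _ _ _ + _ => /[apply] ->; case: ifP.
Qed.

Lemma run_best_ind (P : trajectory R dim -> Prop) k : (k <= N)%N -> P xinit ->
  (forall k, (0 < k <= N)%N -> P (Defs.point (h k))) -> P (best (h k)).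
Proof.
case: run => -[_ b0] _ _ bE _ + Pi Pp; elim: k => [|k ih] kN; first by rewrite b0.
rewrite bE//; case: ifP => _; [exact/ih/ltnW|exact: Pp].
Qed.

Lemma run_gap_le k : (0 < k <= N)%N ->
  gap T x0 X F (h k) <=
  \sum_(1 <= t < T) step L (Defs.point (h k.-1)) (Defs.point (h k)) t.
Proof.
move=> kN; apply: le_trans (forward_gap_le mu_gt0 L_gt0 reg (run_models_valid kN)
  (run_above_cuts kN) (run_forward kN) T_gt0).
by rewrite lerD2r run_best_le.
Qed.

Lemma run_not_stopped k : (0 < k < N)%N -> tol < gap T x0 X F (h k).
Proof.
move=> kN; case: run => _ _ _ _ /(_ k kN)[ns _].
by rewrite ltNge; apply/negP => hg; apply: ns; split=> //; case/andP: kN.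
Qed.

(** The sum of steps is empty, so the first gap is at most 0. This case is separate because the
    exponent of the final bound is then 0, with no power of [1 / eps] to absorb constants. *)
Lemma run_stops_single_stage : T = 1%N -> (N <= 1)%N.
Proof.
move=> T1; rewrite leqNgt; apply/negP => N1.
have := run_not_stopped (k := 1) N1; rewrite ltNge => /negP; apply.
apply: le_trans (run_gap_le (k := 1) (ltnW N1)) _.
by rewrite T1 big_geq// ltW.
Qed.

Lemma run_count_bound (Dm : R) :
  (forall t u v, (0 < t <= T)%N -> X t u -> X t v -> enorm (u - v) <= Dm) ->
  (forall t, (0 < t <= T)%N -> X t (xinit t)) ->
  N%:R <= 2 + (contraction_rate (L / mu) T.-1)^-1 *
    ln (1 + T%:R * (T%:R * (L / 2 * Dm ^+ 2)) / (step_weight (L / mu) T.-1 * tol)).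
Proof.
move=> hD hinit; set th := L / mu; set n := T.-1.
have nT : n.+1 = T by rewrite prednK.
have th1 : 1 <= th by rewrite ler_pdivlMr// mul1r.
have [eb _ /andP[w0 _]] := rates_bounds th1 n.
pose c := L / 2 * Dm ^+ 2.
have c0 : 0 <= c by rewrite mulr_ge0 ?divr_ge0 ?exprn_even_ge0// ltW.
have Wm0 : 0 <= T%:R * (T%:R * c) by rewrite mulr_ge0// mulr_ge0.
pose q k := stage_gap T X F (@models _ _ (h k)) (Defs.point (h k)).
have q0 k : (0 < k <= N)%N -> forall t, (t < n)%N -> 0 <= q k t.
  move=> kN t tn; apply: (stage_gap_ge0 reg _ (run_models_valid kN)).
  by rewrite -nT leqW.
have qn k : (0 < k <= N)%N -> q k n = 0.
  by move=> kN; exact: (stage_gap_last reg _ (run_models_valid kN)).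
have TR : n%:R <= T%:R :> R by rewrite ler_nat -nT.
(* An empty run has no first energy from which [count_bound] could start. *)
case: (posnP N) => [->|N0].
  apply: addr_ge0 => //; apply: mulr_ge0.
    by rewrite invr_ge0 ltW//; case/andP: eb.
  rewrite ln_ge0// lerDl; apply: divr_ge0; last by rewrite ltW// mulr_gt0.
  exact: Wm0.
apply: (@count_bound R _ _ _ _ (fun k => gap T x0 X F (h k)) (fun k => energy th n (q k))) => //.
- exact: run_not_stopped.
- by move=> k kN; apply: energy_ge0 => //; exact: q0.
- have N1 : (0 < 1 <= N)%N by [].
  (* At the first iteration [stage_gap_next] is iterated down from the zero gap of the last stage;
     each of the [j] steps costs at most [c]. *)
  have q1 j t : (t + j = n)%N -> q 1%N t <= j%:R * c.
    elim: j t => [|j ih] t tj; first by rewrite -{1}[t]addn0 tj qn// mul0r.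
    have tT : (t.+1 < T)%N by lia.
    apply: le_trans (stage_gap_next mu_gt0 L_gt0 reg (run_models_valid N1)
      (run_above_cuts N1) (run_forward N1) tT) _.
    have := ih t.+1; rewrite addSnnS => /(_ tj); rewrite -/(q 1%N _) -natr1 mulrDl mul1r.
    suff : step L (Defs.point (h 1.-1)) (Defs.point (h 1)) t.+1 <= c by lra.
    rewrite /step /c; apply: ler_wpM2l; first by rewrite divr_ge0// ltW.
    have tT' : (0 < t.+1 <= T)%N by exact: ltnW.
    have e0 := enorm_ge0 (Defs.point (h 1) t.+1 - Defs.point (h 1.-1) t.+1).
    have e1 : enorm (Defs.point (h 1) t.+1 - Defs.point (h 1.-1) t.+1) <= Dm.
      apply: hD => //; first exact: (forward_feasible (run_forward N1)).
      by case: run => -[/= -> _] _ _ _ _; exact: hinit.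
    by apply: lerXn2r; rewrite ?nnegrE// (le_trans e0).
  apply: le_trans (energy_le (c := n%:R * c) th1 _ _) _; first by rewrite mulr_ge0.
    move=> t tn; apply: le_trans (q1 (n - t)%N t _) _; first by rewrite subnKC// ltnW.
    by rewrite ler_wpM2r// ler_nat leq_subr.
  by apply: ler_pM => //; [rewrite mulr_ge0|exact: ler_wpM2r].
- move=> k /[dup] kN /andP[k0 kN'].
  have kN1 : (0 < k <= N)%N by rewrite k0 ltnW.
  have kN2 : (0 < k.+1 <= N)%N by [].
  have [_ bp] : ~ stopped T x0 X F tol h k /\
     backward_pass T X F (Defs.point (h k)) (@models _ _ (h k)) (@models _ _ (h k.+1)).
    by case: run => _ _ _ _; exact.
  pose d := step L (Defs.point (h k)) (Defs.point (h k.+1)).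
  have d0 : d 0%N = 0.
    by rewrite /d /step (run_forward kN1).1 (run_forward kN2).1 subrr enorm0 expr0n mulr0.
  have := energy_contraction th1 (q0 _ kN1) (q0 _ kN2) (d := d).
  rewrite qn// d0 mulr0 addr0.
  have -> : \sum_(0 <= t < n) d t.+1 = \sum_(1 <= t < T) d t.
    by rewrite -nT big_add1.
  move=> contr; apply: le_trans (contr _ _ _ _) => //.
  + by rewrite lerD2l ler_wpM2l ?(ltW w0)//; exact: run_gap_le.
  + by move=> t; exact: (step_ge0 L_gt0).
  + move=> t B tn B0; have tT : (t.+1 < T)%N by rewrite -nT.
    exact: (stage_gap_decrease mu_gt0 L_gt0 reg B0 tT (run_models_valid kN1)
      (run_forward kN1) (run_forward kN2) bp).
  + move=> t tn; have tT : (t.+1 < T)%N by rewrite -nT.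
    exact: (stage_gap_next mu_gt0 L_gt0 reg (run_models_valid kN2)
      (run_above_cuts kN2) (run_forward kN2) tT).
Qed.

(** Valid models make the first-stage value a lower bound of the optimal cost, so the tested gap
    bounds the suboptimality of the best point. *)
Lemma run_output k (x : trajectory R dim) : (k <= N)%N ->
  stopped T x0 X F tol h k -> x 0%N = x0 ->
  (forall t, (0 < t <= T)%N -> X t (x t)) ->
  total_cost T F (best (h k)) <= total_cost T F x + tol.
Proof.
move=> kN [k0 hg] xx0 hx; have kN' : (0 < k <= N)%N by rewrite k0.
have h1 := value_le_cost_to_go reg x0 T_gt0 ((run_models_valid kN').2 1%N T_gt0).
have h2 := cost_to_go_le reg (u := x) (t := 0%N) hx.
move: hg; rewrite /gap /total_cost -xx0 in h1 *; rewrite /total_cost in h2 *; lra.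
Qed.

Lemma run_extends : ~ stopped T x0 X F tol h N ->
  exists2 h' : nat -> @iterate R dim, (forall k, (k <= N)%N -> h' k = h k) &
    fddp_run T x0 X F tol xinit h' N.+1.
Proof.
move=> ns.
(* An empty run is continued by initial models, any other by a backward pass. *)
have [G [hG vG]] : exists G, [/\ N = 0%N -> initial_models T X F xinit G,
    (0 < N)%N -> backward_pass T X F (Defs.point (h N)) (@models _ _ (h N)) G &
    valid_models T X F G].
  have [N0|N0] := posnP N.
    have [G hG] := initial_models_exist; exists G; split=> //.
    exact: (valid_initial mu_gt0 L_gt0 reg hG).
  have NN : (0 < N <= N)%N by rewrite N0 leqnn.
  have [G hG] := backward_pass_exists (run_models_valid NN) (run_forward NN).
  exists G; split=> //; first by move=> NE; rewrite NE in N0.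
  exact: (valid_backward mu_gt0 L_gt0 reg hG).
move=> vG'.
have [x fx] := forward_pass_exists vG'.
pose y := if total_cost T F (best (h N)) <= total_cost T F x then best (h N) else x.
pose h' k := if (k <= N)%N then h k else Iterate x y G.
have hk k : (k <= N)%N -> h' k = h k by rewrite /h' => ->.
have hN : h' N.+1 = Iterate x y G by rewrite /h' ltnn.
exists h' => //; case: run => init initG fwd bst bwd.
split.
- by rewrite hk.
- move=> _; have [N0|N0] := posnP N; last by rewrite hk//; exact: initG.
  by have -> : 1%N = N.+1 by [rewrite N0]; rewrite hN; exact: hG.
- move=> k /andP[k0]; rewrite leq_eqVlt => /predU1P[->|kN]; first by rewrite hN.
  by rewrite hk//; apply: fwd; rewrite k0.
- move=> k /andP[k0]; rewrite leq_eqVlt => /predU1P[->|kN].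
    by rewrite /= hN hk.
  by rewrite !hk//; [apply: bst; rewrite k0|lia].
- move=> k /andP[k0]; rewrite ltnS leq_eqVlt => /predU1P[kN|kN].
    rewrite kN hN hk//; split; last by apply: vG; rewrite -kN.
    by move: ns; rewrite /stopped hk.
  rewrite !hk//; last exact: ltnW.
  by rewrite /stopped hk ?(ltnW kN)//; apply: bwd; rewrite k0.
Qed.

End one_run.

End runs.

(** * The perturbed penalized problem *)

Section penalized.
Variables (R : realType) (T : nat) (P : problem R).
Hypothesis T_gt0 : (0 < T)%N.
Hypothesis std : standing T P.
Variables (Estar : R) (p : multiplier P).
Hypothesis (optE : optimal_value T P Estar) (optp : optimal_multiplier T Estar p).

Local Notation X t := (@stage_set R P t).
Local Notation D := (diameter T P).

Lemma dot_mulmx m n (r : 'cV[R]_m) (B : 'M[R]_(m, n)) (w : 'cV[R]_n) :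
  dot r (B *m w) = dot (B^T *m r) w.
Proof.
have dotE k (u v : 'cV[R]_k) : dot u v = (u^T *m v) 0 0.
  by rewrite mxE; apply: eq_bigr => i _; rewrite mxE.
by rewrite !dotE trmx_mul trmxK mulmxA.
Qed.

Lemma diam_le_diameter t : (0 < t <= T)%N -> diam (X t) <= D.
Proof.
move=> tT; rewrite /diameter.
by apply: (@le_bigmax_seq _ _ _ _ _ t); rewrite ?mem_index_iota.
Qed.

Lemma diam_gt0 t : (0 < t <= T)%N -> 0 < diam (X t).
Proof. by move=> tT; have [_ _ _ ? _] := std.2 t tT. Qed.

Lemma diameter_gt0 : 0 < D.
Proof.
have T1 : (0 < 1 <= T)%N by [].
exact: lt_le_trans (diam_gt0 T1) (diam_le_diameter T1).
Qed.

Lemma stage_distance_le t u v : (0 < t <= T)%N -> X t u -> X t v ->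
  enorm (u - v) <= diam (X t).
Proof. by move=> tT; have [_ _ cX _ _] := std.2 t tT; exact: enorm_le_diam. Qed.

Lemma matrices_sqr_bound : exists2 M : R, 0 <= M & forall t, (0 < t <= T)%N ->
  (forall u, enorm (matA P t *m u) ^+ 2 <= M * enorm u ^+ 2) /\
  (forall z, enorm (matB P t *m z) ^+ 2 <= M * enorm z ^+ 2).
Proof.
have /choice[c hc] : forall t, exists c : R, 0 <= c /\
    (forall u, enorm (matA P t *m u) ^+ 2 <= c * enorm u ^+ 2) /\
    (forall z, enorm (matB P t *m z) ^+ 2 <= c * enorm z ^+ 2).
  move=> t; have [a a0 ha] := mulmx_enorm_bound (matA P t).
  have [b b0 hb] := mulmx_enorm_bound (matB P t).
  exists (a + b); split; first exact: addr_ge0.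
  split=> [u|z]; [apply: le_trans (ha u) _|apply: le_trans (hb z) _];
    by rewrite ler_wpM2r ?exprn_ge0 ?enorm_ge0// ?lerDl ?lerDr.
exists (\sum_(t < T.+1) c t); first by apply: sumr_ge0 => t _; case: (hc t).
move=> t /andP[_ tT].
have cM : c t <= \sum_(t < T.+1) c t.
  rewrite (bigD1 (Ordinal (tT : (t < T.+1)%N)))//= lerDl.
  by apply: sumr_ge0 => s _; case: (hc s).
have [_ [hA hB]] := hc t.
by split=> [u|z]; [apply: le_trans (hA u) _|apply: le_trans (hB z) _];
  rewrite ler_wpM2r ?exprn_ge0 ?enorm_ge0.
Qed.

Lemma residual_conv t u u' z z' l :
  residual (P := P) (t := t) (l *: u + (1 - l) *: u') (l *: z + (1 - l) *: z') =
  l *: residual u z + (1 - l) *: residual u' z'.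
Proof.
rewrite /residual !mulmxDr -!scalemxAr.
move: (matA P t *m u) (matA P t *m u') (matB P t *m z) (matB P t *m z') => a a' b b'.
by apply/matrixP => i j; rewrite !mxE; ring.
Qed.

Section parameters.
Variables (eps rho : R) (xinit : trajectory R (stage_dim P)).
Hypothesis (eps_gt0 : 0 < eps) (rho_gt0 : 0 < rho).
Hypothesis adm : admissible T xinit.

(** The proximal terms alone provide strong convexity, the [modulus] of a stage being allowed to
    vanish. The largest diameter gives a lower bound common to all stages. *)
Definition pp_modulus : R := eps / (T%:R * D ^+ 2).

Lemma pp_modulus_gt0 : 0 < pp_modulus.
Proof. by rewrite divr_gt0// mulr_gt0 ?ltr0n// exprn_gt0// diameter_gt0. Qed.

Local Notation F := (pp_cost T eps rho xinit).
Local Notation prox t := (eps / (2 * T%:R * diam (X t) ^+ 2)).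

Lemma prox_ge t : (0 < t <= T)%N -> pp_modulus / 2 <= prox t.
Proof.
move=> tT; have d0 := diam_gt0 tT; have D0 := diameter_gt0.
have T0 : 0 < T%:R :> R by rewrite ltr0n.
have -> : pp_modulus / 2 = eps / (2 * T%:R * D ^+ 2).
  by rewrite /pp_modulus; field; rewrite !gt_eqF.
rewrite ler_pM2l// lef_pV2 ?posrE ?mulr_gt0 ?exprn_gt0//.
apply: ler_wpM2l; first by rewrite mulr_ge0.
by apply: lerXn2r; rewrite ?nnegrE; [exact: ltW|exact: ltW|exact: diam_le_diameter].
Qed.

(** Only the penalty couples consecutive stages: the objective and the proximal term cancel in mixed
    differences, and the gradient in [z] is that of the penalty. This gives the constant [rho * M];
    adding the modulus ensures [mu <= L], even if [M = 0]. *)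
Lemma pp_regular M : 0 <= M ->
  (forall t, (0 < t <= T)%N ->
    (forall u, enorm (matA P t *m u) ^+ 2 <= M * enorm u ^+ 2) /\
    (forall z, enorm (matB P t *m z) ^+ 2 <= M * enorm z ^+ 2)) ->
  regular_stages T (fun t => X t) F pp_modulus (rho * M + pp_modulus).
Proof.
move=> M0 hM; have mu0 := pp_modulus_gt0.
have cE t : (0 < t <= T)%N -> convex_on setT (@stage_obj R P t).
  move=> tT u v l _ _ l01; have [_ _ _ _ [a0 /(_ u v l l01)]] := std.2 t tT.
  move/le_trans; apply; rewrite gerBl; have /andP[l0 l1] := l01.
  apply: mulr_ge0; last by rewrite exprn_ge0// enorm_ge0.
  by rewrite mulr_ge0 ?subr_ge0// mulr_ge0// divr_ge0.
have prox0 t : (0 < t <= T)%N -> 0 <= prox t.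
  by move=> tT; apply: le_trans (prox_ge tT); rewrite divr_ge0// ltW.
split.
- move=> t tT; have [X0 cX kX _ _] := std.2 t tT.
  by split=> //; exact/convex_setP.
- move=> t tT; have [X0 cX kX _ _] := std.2 t tT.
  have [u0 [_ hu0]] := lsc_at_argmin kX X0 (lsc_at_convex (X := X t) (cE t tT)).
  exists (stage_obj u0) => u z Xu; rewrite /pp_cost -addrA.
  apply: ler_wpDr; last exact: hu0.
  apply: addr_ge0; apply: mulr_ge0; rewrite ?exprn_ge0 ?enorm_ge0//.
    by rewrite divr_ge0// ltW.
  exact: prox0.
- move=> t u u' z z' l tT l01; have /andP[l0 l1] := l01.
  rewrite /pp_cost residual_conv sqr_enorm_conv.
  have -> : l *: u + (1 - l) *: u' - xinit t =
            l *: (u - xinit t) + (1 - l) *: (u' - xinit t).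
    by apply/matrixP => i j; rewrite !mxE; ring.
  rewrite sqr_enorm_conv.
  have -> : u - xinit t - (u' - xinit t) = u - u'.
    by apply/matrixP => i j; rewrite !mxE; ring.
  have h1 := cE t tT u u' l I I l01.
  have ll : 0 <= l * (1 - l) by rewrite mulr_ge0// subr_ge0.
  have h2 : 0 <= rho / 2 * (l * (1 - l) * enorm (residual u z - residual u' z') ^+ 2).
    apply: mulr_ge0; first by rewrite divr_ge0// ltW.
    by rewrite mulr_ge0// exprn_ge0// enorm_ge0.
  have h3 : pp_modulus / 2 * (l * (1 - l) * enorm (u - u') ^+ 2) <=
            prox t * (l * (1 - l) * enorm (u - u') ^+ 2).
    by apply: ler_wpM2r (prox_ge tT); rewrite mulr_ge0// exprn_ge0// enorm_ge0.
  move: h1 h2 h3; set c := prox t; lra.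
- move=> t u u' z z' tau tT tau0; have [hA hB] := hM t tT.
  have cross : enorm (residual u z') ^+ 2 - enorm (residual u z) ^+ 2
      - enorm (residual u' z') ^+ 2 + enorm (residual u' z) ^+ 2 =
      2 * dot (matA P t *m (u - u')) (matB P t *m (z' - z)).
    rewrite /residual !mulmxBr.
    move: (matA P t *m u) (matA P t *m u') (matB P t *m z) (matB P t *m z') => a a' b b'.
    rewrite !sqr_enorm !(dotDl, dotDr, dotNl, dotNr).
    rewrite (dotC b a) (dotC b' a) (dotC b a') (dotC b' a').
    by rewrite ?(dotC (rhs t)); ring.
  have young := dot_young (matA P t *m (u - u')) (matB P t *m (z' - z)) tau0.
  have hA' := ler_wpM2l (ltW tau0) (hA (u - u')).
  have ti : 0 <= tau^-1 by rewrite invr_ge0 ltW.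
  have hB' := ler_wpM2r ti (hB (z' - z)).
  set a := enorm (u - u') ^+ 2 in hA' *; set b := enorm (z' - z) ^+ 2 in hB' *.
  have ab0 : 0 <= tau * a + b / tau.
    by rewrite addr_ge0// mulr_ge0 ?exprn_ge0 ?enorm_ge0// ltW.
  have : rho / 2 * (2 * dot (matA P t *m (u - u')) (matB P t *m (z' - z))) <=
         rho / 2 * (M * (tau * a + b / tau)).
    by apply: ler_wpM2l; [rewrite divr_ge0// ltW|lra].
  rewrite -cross /pp_cost.
  have : 0 <= pp_modulus / 2 * (tau * a + b / tau) by rewrite mulr_ge0// divr_ge0// ltW.
  lra.
- move=> t u z tT; have [_ hB] := hM t tT.
  exists (rho *: ((matB P t)^T *m residual u z)) => z'.
  rewrite dotZl -dot_mulmx /pp_cost.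
  have -> : residual u z' = residual u z + matB P t *m (z' - z).
    by rewrite /residual mulmxBr; apply/matrixP => i j; rewrite !mxE; ring.
  have := ler_wpM2l (ltW rho_gt0) (hB (z' - z)).
  have : 0 <= pp_modulus * enorm (z' - z) ^+ 2.
    by rewrite mulr_ge0 ?exprn_ge0 ?enorm_ge0// ltW.
  have -> : enorm (residual u z + matB P t *m (z' - z)) ^+ 2 =
     enorm (residual u z) ^+ 2 + 2 * dot (residual u z) (matB P t *m (z' - z)) +
     enorm (matB P t *m (z' - z)) ^+ 2.
    move: (residual u z) (matB P t *m (z' - z)) => r w.
    by rewrite !sqr_enorm !(dotDl, dotDr) (dotC w r); ring.
  lra.
Qed.

Lemma pp_eps_solution y : (4 * multiplier_norm T p + 8) / eps <= rho ->
  admissible T y ->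
  (forall x, admissible T x -> total_cost T F y <= total_cost T F x + eps / 2) ->
  eps_solution T Estar eps y.
Proof.
move=> hrho ady hy.
have T0 : 0 < T%:R :> R by rewrite ltr0n.
have [[xs [adx resx EE]] _] := optE.
pose S := \sum_(1 <= t < T.+1) enorm (residual (y t) (y t.-1)) ^+ 2.
have S0 : 0 <= S by apply: sumr_ge0 => t _; rewrite exprn_ge0// enorm_ge0.
have up : total_cost T F xs <= Estar + eps / 2.
  rewrite EE /objective /total_cost.
  (* This is the share of each stage: its proximal term compares two points of a set whose squared
     diameter cancels the denominator. *)
  have -> : eps / 2 = \sum_(1 <= t < T.+1) eps / (2 * T%:R).
    by rewrite sumr_const_nat subn1 /= -[RHS]mulr_natr; field; rewrite gt_eqF.
  rewrite -big_split/= big_nat [leRHS]big_nat; apply: ler_sum => t tT.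
  rewrite /pp_cost resx// enorm0 expr0n/= mulr0 addr0 lerD2l.
  have d0 := diam_gt0 tT.
  have -> : eps / (2 * T%:R) = prox t * diam (X t) ^+ 2.
    by field; rewrite !gt_eqF.
  apply: ler_wpM2l.
    by rewrite divr_ge0 ?(ltW eps_gt0)// mulr_ge0 ?exprn_ge0 ?mulr_ge0// ltW.
  have [tT1 tT2] := andP tT.
  apply: lerXn2r; rewrite ?nnegrE ?enorm_ge0//; first exact: ltW.
  by apply: stage_distance_le => //; [exact: adx|exact: adm].
have low : objective T y + rho / 2 * S <= total_cost T F y.
  rewrite /objective /S mulr_sumr -big_split/= /total_cost.
  rewrite big_nat [leRHS]big_nat; apply: ler_sum => t tT.
  rewrite /pp_cost lerDl mulr_ge0 ?exprn_ge0 ?enorm_ge0//.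
  apply: le_trans (prox_ge tT); rewrite divr_ge0// ltW//; exact: pp_modulus_gt0.
have pen : objective T y + rho / 2 * S <= Estar + eps.
  by have := hy xs adx; lra.
have S_le : 0 <= rho / 2 * S by rewrite mulr_ge0// divr_ge0// ltW.
split=> //; first lra.
set Pn := multiplier_norm T p in hrho.
have Pn0 : 0 <= Pn := sqrtr_ge0 _.
have PE : Pn ^+ 2 = \sum_(1 <= t < T.+1) enorm (p t) ^+ 2.
  by rewrite sqr_sqrtr// sumr_ge0// => t _; rewrite exprn_ge0// enorm_ge0.
(* The Young parameter balances the two errors: [S / (2 * a)] stays below a quarter of the penalty
   by the lower bound on [rho], and the multiplier costs at most [eps * Pn / 2]. The 1 keeps [a]
   defined when the multiplier vanishes. *)
pose a := eps / (Pn + 1).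
have P1 : 0 < Pn + 1 by lra.
have a0 : 0 < a by rewrite divr_gt0.
have mult : Estar <= objective T y + (a / 2 * Pn ^+ 2 + S / (2 * a)).
  apply: (@le_trans _ _ (objective T y +
    \sum_(1 <= t < T.+1) dot (p t) (residual (y t) (y t.-1)))).
    by case: optp => _; apply; exists y.
  rewrite lerD2l PE /S mulr_sumr mulr_suml -big_split/=.
  apply: ler_sum => t _.
  have := dot_young (p t) (residual (y t) (y t.-1)) a0.
  have -> : enorm (residual (y t) (y t.-1)) ^+ 2 / (2 * a) =
     (enorm (residual (y t) (y t.-1)) ^+ 2 / a) / 2 by field; rewrite gt_eqF.
  lra.
rewrite -/S.
have key : rho / 2 * S <= eps + (a / 2 * Pn ^+ 2 + S / (2 * a)) by lra.
have aE : S / (2 * a) * eps = S * (Pn + 1) / 2.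
  by rewrite /a; field; rewrite !gt_eqF.
have aP : a * Pn ^+ 2 <= eps * Pn.
  rewrite /a mulrAC ler_pdivrMr// -mulrA ler_wpM2l ?(ltW eps_gt0)//; nra.
have rE : 4 * Pn + 8 <= rho * eps by rewrite -ler_pdivrMr.
have k2 := ler_wpM2r (ltW eps_gt0) key.
have k3 := ler_wpM2r S0 rE.
have k4 := ler_wpM2r (ltW eps_gt0) aP.
have k5 : (3 / 2 * Pn + 7 / 2) * S <= (1 + Pn / 2) * eps ^+ 2.
  by move: k2 k3 k4 aE; move: (S / (2 * a)) => b; lra.
have e2 : 0 <= eps ^+ 2 by rewrite exprn_ge0// ltW.
have c0 : 0 < 3 / 2 * Pn + 7 / 2 by lra.
have : (3 / 2 * Pn + 7 / 2) * S <= (3 / 2 * Pn + 7 / 2) * eps ^+ 2.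
  by apply: le_trans k5 _; apply: ler_wpM2r => //; lra.
by rewrite ler_pM2l.
Qed.

Lemma pp_solves (bound : R) : (4 * multiplier_norm T p + 8) / eps <= rho ->
  (forall h N, fddp_run T (@start R P) (@stage_set R P) F (eps / 2) xinit h N ->
     N%:R <= bound) ->
  fddp_solves_within T Estar eps rho xinit bound.
Proof.
(* The anonymous names are the three local definitions in [fddp_solves_within]. *)
move=> hrho hb ? ? ? h N run; have [M M0 hM] := matrices_sqr_bound.
have reg := pp_regular M0 hM.
have mu0 := pp_modulus_gt0.
have muL : pp_modulus <= rho * M + pp_modulus by rewrite lerDr mulr_ge0// ltW.
split; first exact: (hb _ _ run).
  exact: (run_extends mu0 muL reg T_gt0 (divr_gt0 eps_gt0 (ltr0Sn R 1)) run).
move=> st; apply: pp_eps_solution => //.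
  refine (run_best_ind run (P := @admissible R T P) (leqnn N) adm _) => k kN t.
  have [f0 ft] := run_forward run kN.
  case: t => [_|t tT]; first by rewrite f0 std.1.
  by have [] := ft t.+1 tT.
move=> x ax; apply: (run_output mu0 muL reg T_gt0 run (leqnn N) st).
  by have := ax 0%N isT; rewrite std.1.
by move=> t /andP[_ tT]; exact: ax.
Qed.

Lemma pp_count_bound M : 0 <= M ->
  (forall t, (0 < t <= T)%N ->
    (forall u, enorm (matA P t *m u) ^+ 2 <= M * enorm u ^+ 2) /\
    (forall z, enorm (matB P t *m z) ^+ 2 <= M * enorm z ^+ 2)) ->
  let L := rho * M + pp_modulus in
  forall h N, fddp_run T (@start R P) (@stage_set R P) F (eps / 2) xinit h N ->
  N%:R <= 2 + (contraction_rate (L / pp_modulus) T.-1)^-1 *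
    ln (1 + T%:R * (T%:R * (L / 2 * D ^+ 2)) /
            (step_weight (L / pp_modulus) T.-1 * (eps / 2))).
Proof.
move=> M0 hM L h N run; have reg := pp_regular M0 hM.
have mu0 := pp_modulus_gt0.
have muL : pp_modulus <= rho * M + pp_modulus by rewrite lerDr mulr_ge0// ltW.
apply: (run_count_bound mu0 muL reg T_gt0 _ run); first by rewrite divr_gt0.
- move=> t u v tT Xu Xv; apply: le_trans (diam_le_diameter tT).
  exact: stage_distance_le.
- by move=> t /andP[_ tT]; exact: adm.
Qed.

End parameters.

End penalized.

(** * Termination and complexity *)

Section theorem.
Variables (R : realType) (T : nat).
Hypothesis T_gt0 : (0 < T)%N.

Lemma penalty_gt0 (P : problem R) (p : multiplier P) (eps rho : R) : 0 < eps ->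
  (4 * multiplier_norm T p + 8) / eps <= rho -> 0 < rho.
Proof.
move=> eps0; apply: lt_le_trans; apply: divr_gt0 => //.
by have := sqrtr_ge0 (\sum_(1 <= t < T.+1) enorm (p t) ^+ 2); rewrite /multiplier_norm; lra.
Qed.

Lemma fddp_terminates (P : problem R) (Estar : R) (p : multiplier P) :
  standing T P -> optimal_value T P Estar -> optimal_multiplier T Estar p ->
  forall (eps rho : R) (xinit : trajectory R (stage_dim P)),
    0 < eps -> (4 * multiplier_norm T p + 8) / eps <= rho ->
    admissible T xinit ->
  exists N : nat, fddp_solves_within T Estar eps rho xinit N%:R.
Proof.
move=> std optE optp eps rho xinit eps0 hrho adm.
have rho0 := penalty_gt0 eps0 hrho.
have [M M0 hM] := matrices_sqr_bound T P.
have [B count] : exists B : R, forall h N, fddp_run T (@start R P) (@stage_set R P)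
    (pp_cost T eps rho xinit) (eps / 2) xinit h N -> N%:R <= B.
  by eexists => h N; exact: (pp_count_bound T_gt0 std eps0 rho0 adm M0 hM).
exists (Num.bound `|B|).
apply: (pp_solves T_gt0 std optE optp eps0 rho0 adm hrho) => h N run.
apply: le_trans (count h N run) _.
by apply: le_trans (ler_norm B) _; rewrite ltW// archi_boundP.
Qed.

Lemma fddp_complexity (P : problem R) (Estar : R) (p : multiplier P) (K : R) :
  standing T P -> optimal_value T P Estar -> optimal_multiplier T Estar p ->
  exists2 eps0 : R, 0 < eps0 &
  forall (eps rho : R) (xinit : trajectory R (stage_dim P)),
    0 < eps -> eps <= eps0 ->
    (4 * multiplier_norm T p + 8) / eps <= rho -> rho <= K / eps ->
    admissible T xinit ->
  fddp_solves_within T Estar eps rho xinit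
    ((T%:R ^+ 2 * diameter T P ^+ 4 / eps ^+ 4) ^+ (2 ^ (T - 1) - 1)%N
       * ln (1 / eps)).
Proof.
move=> std optE optp; have [M M0 hM] := matrices_sqr_bound T P.
have D0 := diameter_gt0 T_gt0 std; set D := diameter T P in D0 *.
have T0 : 0 < T%:R :> R by rewrite ltr0n.
have [T1|[i TE]] : T = 1%N \/ exists i, T = i.+2.
  by case: T T_gt0 => [|[|i]] // _; [left|right; exists i].
  (* For [T = 1] the bound is [ln (1 / eps)], and this threshold makes it at least 1. *)
  exists (expR (- 1)); first exact: expR_gt0.
  move=> eps rho xinit eps0 epse hrho _ adm.
  have rho0 := penalty_gt0 eps0 hrho.
  apply: (pp_solves T_gt0 std optE optp eps0 rho0 adm hrho) => h N run.
  rewrite [in leRHS]T1 subnn expr0 mul1r.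
  have N1 : (N <= 1)%N.
    have reg := pp_regular T_gt0 std xinit eps0 rho0 M0 hM.
    have mu0 := pp_modulus_gt0 T_gt0 std eps0.
    have muL : pp_modulus T P eps <= rho * M + pp_modulus T P eps.
      by rewrite lerDr mulr_ge0// ltW.
    exact: (run_stops_single_stage mu0 muL reg T_gt0 (divr_gt0 eps0 (ltr0Sn R 1)) run T1).
  apply: (@le_trans _ _ 1); first by rewrite (ler_nat R N 1).
  rewrite div1r lnV ?posrE// -[1](opprK 1) lerN2 -(expRK (-1)).
  by rewrite ler_ln ?posrE ?expR_gt0.
(* Since [rho <= K / eps], [L * eps] is at most [|K| * M + mu * eps], and [mu * eps] is at most
   [1 / (T * D^2)] once [eps <= 1]. Hence [theta] is at most this constant over [eps^2], and [w]
   bounds the initial energy in the same way. The absolute value provides positivity for any [K]. *)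
have c1 : 0 < `|K| * M * (T%:R * D ^+ 2) + 1.
  by rewrite ltr_wpDl// mulr_ge0// ?mulr_ge0// ?exprn_ge0// ltW.
pose w := T%:R * (T%:R * ((`|K| * M + 1 / (T%:R * D ^+ 2)) / 2 * D ^+ 2)).
have TD0 : 0 < T%:R * D ^+ 2 by rewrite mulr_gt0// exprn_gt0.
have KM0 : 0 <= `|K| * M by rewrite mulr_ge0.
have w0 : 0 < w.
  rewrite /w; do 2!(apply: mulr_gt0 => //).
  apply: mulr_gt0; last by rewrite exprn_gt0.
  by rewrite divr_gt0// ltr_wpDl// divr_gt0.
have KD : 0 < T%:R ^+ 2 * D ^+ 4 by rewrite mulr_gt0 ?exprn_gt0.
have [e0 e0_gt0 asym] := asymptotic_bound i KD c1 w0.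
exists (Num.min e0 1); first by rewrite lt_min e0_gt0 ltr01.
move=> eps rho xinit eps0; rewrite le_min => /andP[epse eps1] hrho hK adm.
have rho0 := penalty_gt0 eps0 hrho.
apply: (pp_solves T_gt0 std optE optp eps0 rho0 adm hrho) => h N run.
have mu0 := pp_modulus_gt0 T_gt0 std eps0; set mu := pp_modulus T P eps in mu0.
have muE : mu = eps / (T%:R * D ^+ 2) by [].
apply: le_trans (pp_count_bound T_gt0 std eps0 rho0 adm M0 hM run) _.
rewrite -/mu -/D; set L := rho * M + mu; set Wm := T%:R * _.
have TE1 : T.-1 = i.+1 by rewrite TE.
have TE2 : (T - 1)%N = i.+1 by rewrite subn1.
have e2 : 0 < eps ^+ 2 by rewrite exprn_gt0.
have e2e : eps ^+ 2 <= eps by rewrite expr2 ger_pMl.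
have LE : L * eps <= `|K| * M + mu * eps.
  rewrite /L mulrDl lerD2r mulrAC ler_wpM2r//.
  by apply: le_trans (ler_norm K); rewrite -ler_pdivlMr.
have L0 : 0 < L by rewrite ltr_wpDl// mulr_ge0// ltW.
have mue : mu * eps <= 1 / (T%:R * D ^+ 2).
  rewrite muE mulrAC ler_pM2r ?invr_gt0// -expr2; exact: le_trans e2e eps1.
have Le : L * eps ^+ 2 <= `|K| * M + 1 / (T%:R * D ^+ 2).
  apply: le_trans (le_trans LE _); last by rewrite lerD2l.
  by rewrite ler_wpM2l// ltW.
rewrite TE1 TE2; apply: asym => //.
- by rewrite ler_pdivlMr// mul1r /L lerDr mulr_ge0// ltW.
- rewrite ler_pdivlMr//.
  have -> : L / mu * eps ^+ 2 = (L * eps) * (T%:R * D ^+ 2).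
    by rewrite muE; field; rewrite !gt_eqF.
  apply: le_trans (ler_wpM2r (ltW TD0) (le_trans LE (lerD (lexx _) mue))) _.
  by rewrite mulrDl div1r mulVf// gt_eqF.
- by rewrite /Wm mulr_ge0// mulr_ge0// mulr_ge0 ?divr_ge0 ?exprn_even_ge0// ltW.
- rewrite ler_pdivlMr// /Wm /w.
  have -> : T%:R * (T%:R * (L / 2 * D ^+ 2)) * eps ^+ 2 =
            T%:R * (T%:R * ((L * eps ^+ 2) / 2 * D ^+ 2)) by ring.
  rewrite !ler_pM2l// ler_pM2r ?exprn_gt0// ler_pM2r//.
Qed.

End theorem.

Unset Implicit Arguments.
Set Strict Implicit.
Set Printing Implicit Defensive.

Theorem theorem2p4 (R : realType) (T : nat) (T_gt0 : (0 < T)%N) :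
  (forall (P : problem R) (Estar : R) (p : multiplier P),
     standing T P -> optimal_value T P Estar -> optimal_multiplier T Estar p ->
   forall (eps rho : R) (xinit : trajectory R (stage_dim P)),
     0 < eps -> (4 * multiplier_norm T p + 8) / eps <= rho ->
     admissible T xinit ->
   exists N : nat, fddp_solves_within T Estar eps rho xinit N%:R) /\
  (* O(.) as eps tends to 0: the hidden constant C depends only on T and on
     bounds M of the norms of A_t, B_t and K of rho * eps; for fixed eps no
     bound is uniform in rho *)
  (forall M K : R, exists2 C : R, 0 < C &
   forall (P : problem R) (Estar : R) (p : multiplier P),
     standing T P -> optimal_value T P Estar -> optimal_multiplier T Estar p ->
     matrices_bounded T P M ->
   exists2 eps0 : R, 0 < eps0 &
   forall (eps rho : R) (xinit : trajectory R (stage_dim P)),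
     0 < eps -> eps <= eps0 ->
     (4 * multiplier_norm T p + 8) / eps <= rho -> rho <= K / eps ->
     admissible T xinit ->
   fddp_solves_within T Estar eps rho xinit
     (C * (T%:R ^+ 2 * diameter T P ^+ 4 / eps ^+ 4) ^+ (2 ^ (T - 1) - 1)%N
        * ln (1 / eps))).
Proof.
split; first exact: fddp_terminates.
(* The threshold [eps0] is chosen after the problem, so it has already absorbed every constant and
   [C = 1] is enough. *)
move=> M K; exists 1 => // P Estar p std optE optp _.
have [e0 e0_gt0 bound] := fddp_complexity T_gt0 K std optE optp.
by exists e0 => // *; rewrite mul1r; apply: bound.
Qed.
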